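(* Let $H$ be a Hilbert space, $C,D\in\mathbb{R}_{>0}$, and let $F,G:\mathring{C}_\infty(\mathbb{R};H)\to\mathring{C}_\infty^+(\mathbb{R};H)'$ be such that for every $\varrho>\max\{C,D\}$ there exists $K>0$ with $$|F(u)(\psi)-F(w)(\psi)|\le C|\psi|_{-\varrho,0}|u-w|_{\varrho,0},\quad|G(u)(\psi)-G(w)(\psi)|\le D|\psi|_{-\varrho,0}|u-w|_{\varrho,0},$$ $$|F(0)(\psi)|\le K|\psi|_{-\varrho,0},\quad|G(0)(\psi)|\le K|\psi|_{-\varrho,0}$$ for all $u,w\in\mathring{C}_\infty(\mathbb{R};H)$, $\psi\in\mathring{C}_\infty^+(\mathbb{R};H)$. Let $\varrho>\max\{C,D\}$, $u_0,w_0\in H$, let $F_\varrho,G_\varrho$ be the continuous extensions of $F,G$ as mappings within $H_{\varrho,0}(\mathbb{R})\otimes H$, and let $u,w\in H_{\varrho,0}(\mathbb{R})\otimes H$ be solutions of $$\partial_{0,\varrho}u=F_\varrho(u)+\delta\otimes u_0\quad\text{and}\quad\partial_{0,\varrho}w=G_\varrho(w)+\delta\otimes w_0$$ in $H_{\varrho,-1}(\mathbb{R})\otimes H$. Then $$|u-w|_{\varrho,0}\le\frac{1}{2\varrho-(C+D)}\Big(\sqrt{2\varrho}\,|u_0-w_0|_H+2\sup_{x\in H_{\varrho,0}(\mathbb{R})\otimes H}|F_\varrho(x)-G_\varrho(x)|_{\varrho,0}\Big).$$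
   Context: $H$ is a Hilbert space over $\mathbb{K}\in\{\mathbb{R},\mathbb{C}\}$. For $\varrho\in\mathbb{R}$, $H_{\varrho,0}(\mathbb{R})\otimes H$ is the Hilbert space of (classes of) measurable $f:\mathbb{R}\to H$ with $|f|_{\varrho,0}^2=\int_{\mathbb{R}}|f(t)|_H^2e^{-2\varrho t}dt<\infty$. For $\varrho\ne0$, $\partial_{0,\varrho}$ is the derivative in $H_{\varrho,0}(\mathbb{R})\otimes H$ with domain $\{f: f'\in H_{\varrho,0}(\mathbb{R})\otimes H\}$ ($f'$ distributional derivative); $H_{\varrho,1}(\mathbb{R})\otimes H$ is its domain with norm $|f|_{\varrho,1}=|\partial_{0,\varrho}f|_{\varrho,0}$. $H_{\varrho,-1}(\mathbb{R})\otimes H$ is the space of continuous linear functionals on $H_{-\varrho,1}(\mathbb{R})\otimes H$, containing $H_{\varrho,0}(\mathbb{R})\otimes H$ via $f\mapsto(\psi\mapsto\int\langle f(t),\psi(t)\rangle_Hdt)$; $\partial_{0,\varrho}$ extends to a unitary operator from $H_{\varrho,0}(\mathbb{R})\otimes H$ onto $H_{\varrho,-1}(\mathbb{R})\otimes H$ by $(\partial_{0,\varrho}f)(\psi)=\int\langle f(t),-(\partial_{0,-\varrho}\psi)(t)\rangle_Hdt$. For $v\in H$, $\delta\otimes v:=\partial_{0,\varrho}(t\mapsto\chi_{\mathbb{R}_{>0}}(t)v)$. $\mathring{C}_\infty(\mathbb{R};H)$: smooth compactly supported $H$-valued functions; $\mathring{C}_\infty^+(\mathbb{R};H)$: smooth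 $\phi:\mathbb{R}\to H$ with $\sup\operatorname{supp}\phi<\infty$ and some derivative $\phi^{(n)}$ compactly supported; $\mathring{C}_\infty^+(\mathbb{R};H)'$: all linear maps $\mathring{C}_\infty^+(\mathbb{R};H)\to\mathbb{K}$; a functional $w$ with $|w(\psi)|\le c|\psi|_{-\varrho,0}$ is identified with the $f\in H_{\varrho,0}(\mathbb{R})\otimes H$ such that $w(\psi)=\int\langle f(t),\psi(t)\rangle_Hdt$. *)

(* Defs.v *)
From HB Require Import structures.
From mathcomp Require Import all_boot all_order all_algebra.
From mathcomp Require Import all_classical all_reals all_analysis.
From mathcomp Require Import complex.
Import Order.TTheory GRing.Theory Num.Theory.
Import numFieldNormedType.Exports.
Set Implicit Arguments. Unset Strict Implicit. Unset Printing Implicit Defensive.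
Local Open Scope classical_set_scope.
Local Open Scope ring_scope.

Definition scal (R : realType) (b : bool) : numFieldType :=
  if b then (R[i] : numFieldType) else (R : numFieldType).

Definition sconj (R : realType) (b : bool) : scal R b -> scal R b :=
  match b return scal R b -> scal R b with
  | true => fun z : R[i] => conjc z
  | false => fun z : R => z
  end.

Definition sre (R : realType) (b : bool) : scal R b -> R :=
  match b return scal R b -> R with
  | true => fun z : R[i] => complex.Re z
  | false => fun z : R => z
  end.

Definition sim (R : realType) (b : bool) : scal R b -> R :=
  match b return scal R b -> R with
  | true => fun z : R[i] => complex.Im z
  | false => fun _ => 0
  end.

Definition sofR (R : realType) (b : bool) : R -> scal R b :=
  match b return R -> scal R b with
  | true => fun x => Complex x 0
  | false => fun x => x
  end.

Definition kemb (R : realType) (b : bool) : R -> R -> scal R b :=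
  match b return R -> R -> scal R b with
  | true => fun x y => Complex x y
  | false => fun x _ => x
  end.

Definition kabs (R : realType) (b : bool) (z : scal R b) : R := sre `|z|.

Section Spaces.
Context (R : realType) (b : bool).
Local Notation K := (scal R b).
Context (H : lmodType K) (ip : H -> H -> K).

Definition hnorm (x : H) : R := Num.sqrt (sre (ip x x)).

Definition is_hilbert : Prop :=
  [/\ (forall (a : K) (x y z : H), ip x (a *: y + z) = a * ip x y + ip x z),
      (forall x y : H, ip y x = sconj (ip x y)),
      (forall x : H, 0 <= ip x x),
      (forall x : H, ip x x = 0 -> x = 0) &
      (forall s : nat -> H,
         (forall e : R, 0 < e -> exists N : nat, forall m n : nat,
             (N <= m)%N -> (N <= n)%N -> hnorm (s m - s n) < e) ->
         exists l : H, forall e : R, 0 < e -> exists N : nat, forall n : nat,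
             (N <= n)%N -> hnorm (s n - l) < e)].

Definition hderiv (f : R -> H) (t : R) (v : H) : Prop :=
  (fun h : R => hnorm ((sofR b h)^-1 *: (f (t + h) - f t) - v))
    @ dnbhs (0 : R) --> (0 : R).

Definition Cc (f : R -> H) : Prop :=
  (exists Dv : nat -> R -> H, Dv 0%N = f /\
     forall (n : nat) (t : R), hderiv (Dv n) t (Dv n.+1 t)) /\
  (exists M : R, forall t : R, M < `|t| -> f t = 0).

Definition Cplus (f : R -> H) : Prop :=
  exists Dv : nat -> R -> H,
  [/\ Dv 0%N = f,
      (forall (n : nat) (t : R), hderiv (Dv n) t (Dv n.+1 t)),
      (exists a : R, forall t : R, a < t -> f t = 0) &
      (exists (n : nat) (M : R), forall t : R, M < `|t| -> Dv n t = 0)].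

Definition smeas (f : R -> H) : Prop :=
  exists s : nat -> R -> H,
    (forall n : nat, finite_set (range (s n)) /\
       forall h : H, measurable (s n @^-1` [set h])) /\
    (forall t : R, (fun n => hnorm (s n t - f t)) @ \oo --> (0 : R)).

Definition wnorm2 (rho : R) (f : R -> H) : \bar R :=
  (\int[@lebesgue_measure R]_t ((hnorm (f t)) ^+ 2 * expR (- (2 * rho * t)))%:E)%E.

Definition L2w (rho : R) (f : R -> H) : Prop :=
  smeas f /\ (wnorm2 rho f < +oo)%E.

Definition wnorm (rho : R) (f : R -> H) : R := Num.sqrt (fine (wnorm2 rho f)).

Definition kint (g : R -> K) : K :=
  kemb b (Rintegral (@lebesgue_measure R) setT (fun t => sre (g t)))
         (Rintegral (@lebesgue_measure R) setT (fun t => sim (g t))).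

Definition pairing (f psi : R -> H) : K := kint (fun t => ip (f t) (psi t)).

Definition test_fun (phi : R -> R) : Prop :=
  (forall (n : nat) (x : R), derivable (iter n (@derive1 R R) phi) x 1) /\
  (exists M : R, forall t : R, M < `|t| -> phi t = 0).

Definition weak_deriv (psi g : R -> H) : Prop :=
  forall (h : H) (phi : R -> R), test_fun phi ->
    kint (fun t => ip (psi t) h * sofR b (derive1 phi t))
    = - kint (fun t => ip (g t) h * sofR b (phi t)).

Definition chi_pos (v : H) : R -> H := fun t => if 0 < t then v else 0.

Definition lin_functional_map (F : (R -> H) -> (R -> H) -> K) : Prop :=
  forall u : R -> H, Cc u ->
  forall (a : K) (psi1 psi2 : R -> H), Cplus psi1 -> Cplus psi2 ->
    F u (fun t => a *: psi1 t + psi2 t) = a * F u psi1 + F u psi2.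

Definition cont_ext (rho : R) (F : (R -> H) -> (R -> H) -> K)
    (Fr : (R -> H) -> R -> H) : Prop :=
  [/\ (forall x : R -> H, L2w rho x -> L2w rho (Fr x)),
      (forall x : R -> H, L2w rho x -> forall e : R, 0 < e ->
         exists2 d : R, 0 < d & forall y : R -> H, L2w rho y ->
           wnorm rho (fun t => y t - x t) < d ->
           wnorm rho (fun t => Fr y t - Fr x t) < e) &
      (forall u : R -> H, Cc u -> forall psi : R -> H, Cplus psi ->
         F u psi = pairing (Fr u) psi)].

(* u in H_{rho,0}(R)(x)H solves  d_{0,rho} u = Fr(u) + delta (x) u0
   in H_{rho,-1}(R)(x)H, i.e. as functionals on H_{-rho,1}(R)(x)H *)
Definition solves (rho : R) (Fr : (R -> H) -> R -> H) (u0 : H) (u : R -> H) : Prop :=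
  L2w rho u /\
  forall psi g : R -> H, L2w (- rho) psi -> L2w (- rho) g -> weak_deriv psi g ->
    pairing u (fun t => - g t)
    = pairing (Fr u) psi + pairing (chi_pos u0) (fun t => - g t).

End Spaces.

(* Main.v *)
(* Let z be the jump part of u - w, equal to u0 - w0 on the positive half-line
   and to 0 elsewhere.  Then v = u - w - z is a weak solution of v' = f with
   f = F(u) - G(w).  Testing with exp(-2 rho t) v gives the energy identity
   rho |v|^2 = Re <v, f>, hence rho |v| <= |f|, while |z| is
   |u0 - w0| / sqrt(2 rho).  Comparing f with F(w) - G(w) and with
   F(u) - G(u) bounds 2 |f| by (C + D) |u - w| + 2 sup |F - G|: by duality F
   and G are Lipschitz on the test functions, and by density everywhere.  Test
   functions are dense because indicators of intervals generate all of L^2 (a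
   Dynkin class argument) and are limits of the bumps
   exp(- c / (t - p) - c / (q - t)) on ]p, q[ as c -> 0. *)
Require Import Defs.
From HB Require Import structures.
From mathcomp Require Import all_boot all_order all_algebra.
From mathcomp Require Import all_classical all_reals all_analysis.
From mathcomp Require Import complex ring lra measurable_realfun.
Import Order.TTheory GRing.Theory Num.Theory.
Import numFieldNormedType.Exports.
Set Implicit Arguments.
Unset Strict Implicit.
Unset Printing Implicit Defensive.
Local Open Scope classical_set_scope.
Local Open Scope ring_scope.

Section Scalars.
Context (R : realType) (b : bool).
Local Notation K := (scal R b).
Implicit Types (x y z : K) (r : R).

Lemma scal_ext x y : sre x = sre y -> sim x = sim y -> x = y.
Proof. by case: b x y => //= -[x1 x2] [y1 y2] /= -> ->. Qed.

Lemma sre_is_zmod_morphism : zmod_morphism (@sre R b).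
Proof. by case: b => //= -[x1 x2] [y1 y2]. Qed.

HB.instance Definition _ :=
  GRing.isZmodMorphism.Build K R (@sre R b) sre_is_zmod_morphism.

Lemma sim_is_zmod_morphism : zmod_morphism (@sim R b).
Proof. by case: b => /= [[x1 x2] [y1 y2]//|x y]; rewrite subr0. Qed.

HB.instance Definition _ :=
  GRing.isZmodMorphism.Build K R (@sim R b) sim_is_zmod_morphism.

Lemma sofR_is_zmod_morphism : zmod_morphism (@sofR R b).
Proof. by case: b => //= r s; apply/eqP; rewrite eq_complex /= subr0 !eqxx. Qed.

HB.instance Definition _ :=
  GRing.isZmodMorphism.Build R K (@sofR R b) sofR_is_zmod_morphism.

Lemma sofR_is_monoid_morphism : monoid_morphism (@sofR R b).
Proof.
case: b; split=> //= r s; apply/eqP.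
by rewrite eq_complex /= !mulr0 mul0r subr0 addr0 !eqxx.
Qed.

HB.instance Definition _ :=
  GRing.isMonoidMorphism.Build R K (@sofR R b) sofR_is_monoid_morphism.

Lemma sre_sofRM r x : sre (sofR b r * x) = r * sre x.
Proof. by case: b x => //= -[x1 x2] /=; rewrite mul0r subr0. Qed.

Lemma sim_sofRM r x : sim (sofR b r * x) = r * sim x.
Proof. by case: b x => /= [[x1 x2]|x]; rewrite ?mulr0//= mul0r addr0. Qed.

Lemma sre_conj x : sre (sconj x) = sre x.
Proof. by case: b x => //= -[]. Qed.

Lemma ler_sre_kabs z : sre z <= kabs z.
Proof.
apply: le_trans (ler_norm _) _; rewrite /kabs; case: b z => //= -[x y] /=.
by rewrite -[leLHS]sqrtr_sqr ler_wsqrtr // lerDl sqr_ge0.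
Qed.

Lemma scal_ge0 z : 0 <= z -> 0 <= sre z /\ sim z = 0.
Proof.
by case: b z => //= -[x y]; rewrite lecE /= => /andP[/eqP -> ->].
Qed.

(* Reduces statements on imaginary parts of inner products to real parts. *)
Lemma sim_as_sre : exists c : K, forall z, sim z = sre (c * z).
Proof.
case: b; last by exists 0 => z; rewrite mul0r.
by exists (Complex 0 (-1)) => -[x y] /=; rewrite mul0r sub0r mulN1r opprK.
Qed.

Lemma sre_kint (g : R -> K) :
  sre (kint g) = \int[@lebesgue_measure R]_t sre (g t).
Proof. by case: b g. Qed.

Lemma sim_kint (g : R -> K) :
  sim (kint g) = \int[@lebesgue_measure R]_t sim (g t).
Proof. by case: b g => //= g; rewrite /Rintegral integral0. Qed.

End Scalars.

Lemma quadratic_ge0_sqr_le (R : rcfType) (p q r : R) :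
  (forall s, 0 <= p * s ^+ 2 + 2 * q * s + r) -> q ^+ 2 <= p * r.
Proof.
move=> h; pose P := Poly [:: r; 2 * q; p].
have : P`_1 ^+ 2 - 4 * P`_2 * P`_0 <= 0.
  apply: deg_le2_poly_ge0 => [|s]; first exact: size_Poly.
  rewrite horner_Poly /= mul0r add0r.
  by rewrite (_ : _ + r = p * s ^+ 2 + 2 * q * s + r) //; ring.
by rewrite !coefE /=; lra.
Qed.

Lemma cvg_dist_le (R : realType) (T : Type) (F : set_system T) {FF : Filter F}
    (u v : T -> R) (l : R) :
  (forall x, `|u x - l| <= v x) -> v @ F --> 0 -> u @ F --> l.
Proof.
move=> uv /cvgrPdist_lt v0; apply/cvgrPdist_lt => e /v0; apply: filterS => x.
rewrite sub0r normrN distrC; apply: le_lt_trans.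
exact: le_trans (uv x) (ler_norm _).
Qed.

Lemma lee_pdivl_addM2 (R : realType) (a c x s t : R) (S : \bar R) :
  0 < a -> a * x <= c + (s + t) ->
  (s%:E <= S -> t%:E <= S -> x%:E <= a^-1%:E * (c%:E + 2%:E * S))%E.
Proof.
move=> a0 dist; case: S => [S| _ _|//]; last first.
  rewrite gt0_muley ?lte_fin // addey // gt0_muley ?lte_fin ?invr_gt0 //.
  exact: leey.
rewrite -(EFinM 2 S) -EFinD -EFinM !lee_fin => sS tS; rewrite ler_pdivlMl //.
by apply: le_trans dist _; rewrite lerD2l mulr2n mulrDl mul1r lerD.
Qed.

Section RealInnerProduct.
Context (R : realType) (b : bool) (H : lmodType (scal R b)).
Context (ip : H -> H -> scal R b) (hH : is_hilbert ip).
Local Notation hn := (hnorm ip).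
Implicit Types (x y z : H) (r s : R).

Definition rip x y : R := sre (ip x y).
Definition rscale r x : H := sofR b r *: x.

Lemma rscaleDl r s x : rscale (r + s) x = rscale r x + rscale s x.
Proof. by rewrite /rscale rmorphD scalerDl. Qed.

Lemma rscaleBl r s x : rscale (r - s) x = rscale r x - rscale s x.
Proof. by rewrite /rscale rmorphB scalerBl. Qed.

Lemma rscaleBr r x y : rscale r (x - y) = rscale r x - rscale r y.
Proof. exact: scalerBr. Qed.

Lemma rscaleA r s x : rscale r (rscale s x) = rscale (r * s) x.
Proof. by rewrite /rscale rmorphM scalerA. Qed.

Lemma rscale1 x : rscale 1 x = x.
Proof. by rewrite /rscale rmorph1 scale1r. Qed.

Lemma rscale0 x : rscale 0 x = 0.
Proof. by rewrite /rscale rmorph0 scale0r. Qed.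

Lemma rscaler0 r : rscale r (0 : H) = 0.
Proof. exact: scaler0. Qed.

Lemma rscaleN1 x : rscale (- 1) x = - x.
Proof. by rewrite /rscale rmorphN1 scaleN1r. Qed.

Lemma ipDr x y z : ip x (y + z) = ip x y + ip x z.
Proof. by case: hH => h _ _ _ _; have := h 1 x y z; rewrite scale1r mul1r. Qed.

Lemma ip0r x : ip x 0 = 0.
Proof. by apply: (addIr (ip x 0)); rewrite -ipDr addr0 add0r. Qed.

Lemma ipZr a x y : ip x (a *: y) = a * ip x y.
Proof.
by case: hH => h _ _ _ _; have := h a x y 0; rewrite ip0r !addr0.
Qed.

Lemma ripC x y : rip x y = rip y x.
Proof. by case: hH => _ conj _ _ _; rewrite /rip conj sre_conj. Qed.

Lemma ripDr x y z : rip x (y + z) = rip x y + rip x z.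
Proof. by rewrite /rip ipDr raddfD. Qed.

Lemma ripDl x y z : rip (y + z) x = rip y x + rip z x.
Proof. by rewrite !(ripC _ x) ripDr. Qed.

Lemma ripZr r x y : rip x (rscale r y) = r * rip x y.
Proof. by rewrite /rip ipZr sre_sofRM. Qed.

Lemma ripZl r x y : rip (rscale r x) y = r * rip x y.
Proof. by rewrite ripC ripZr ripC. Qed.

Lemma ripNr x y : rip x (- y) = - rip x y.
Proof. by rewrite -rscaleN1 ripZr mulN1r. Qed.

Lemma ripNl x y : rip (- x) y = - rip x y.
Proof. by rewrite ripC ripNr ripC. Qed.

Lemma rip_ge0 x : 0 <= rip x x.
Proof. by case: hH => _ _ h _ _; have [] := scal_ge0 (h x). Qed.

Lemma hnorm_sqr x : hn x ^+ 2 = rip x x.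
Proof. by rewrite sqr_sqrtr // rip_ge0. Qed.

Lemma hnorm_ge0 x : 0 <= hn x.
Proof. exact: sqrtr_ge0. Qed.

Lemma hnormZ r x : hn (rscale r x) = `|r| * hn x.
Proof.
rewrite /hnorm -/(rip _ _) ripZl ripZr mulrA -expr2.
by rewrite sqrtrM ?sqr_ge0 // sqrtr_sqr.
Qed.

Lemma hnorm_opp x : hn (- x) = hn x.
Proof. by rewrite -rscaleN1 hnormZ normrN1 mul1r. Qed.

Lemma hnorm0 : hn 0 = 0.
Proof. by rewrite -(rscale0 0) hnormZ normr0 mul0r. Qed.

Lemma hnorm_eq0 x : hn x = 0 -> x = 0.
Proof.
move=> x0; case: hH => _ _ ge0 h _; apply: h.
have [_ i0] := scal_ge0 (ge0 x).
have r0 : rip x x = 0 by rewrite -hnorm_sqr x0 expr0n.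
by apply: scal_ext; rewrite ?i0 ?[LHS]r0 raddf0.
Qed.

Lemma CauchySchwarz_rip x y : `|rip x y| <= hn x * hn y.
Proof.
rewrite -sqrtr_sqr /hnorm -sqrtrM ?rip_ge0 //; apply: ler_wsqrtr.
apply: quadratic_ge0_sqr_le => s; rewrite -!/(rip _ _).
have := rip_ge0 (rscale s x + y).
by rewrite !(ripDl, ripDr, ripZl, ripZr) (ripC y x); lra.
Qed.

Lemma ler_hnormD x y : hn (x + y) <= hn x + hn y.
Proof.
rewrite -(@ler_pXn2r _ 2) ?nnegrE ?addr_ge0 ?hnorm_ge0 //.
rewrite sqrrD !hnorm_sqr ripDl !ripDr (ripC y x).
by have := le_trans (ler_norm _) (CauchySchwarz_rip x y); lra.
Qed.

Lemma hnorm_distrC x y : hn (x - y) = hn (y - x).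
Proof. by rewrite -hnorm_opp opprB. Qed.

Lemma ler_hnormB x y : hn (x - y) <= hn x + hn y.
Proof. by rewrite -(hnorm_opp y) ler_hnormD. Qed.

Lemma ler_dist_hnorm x y : `|hn x - hn y| <= hn (x - y).
Proof.
have := ler_hnormD (x - y) y; have := ler_hnormD (y - x) x.
by rewrite !subrK (hnorm_distrC y x) ler_norml; lra.
Qed.

Lemma rip_polarization x y :
  rip x y = (hn (x + y) ^+ 2 - hn (x - y) ^+ 2) / 4.
Proof.
rewrite !hnorm_sqr !(ripDl, ripDr, ripNl, ripNr) (ripC y x).
by field.
Qed.

Lemma cvg_rscale (T : Type) (F : set_system T) {FF : Filter F} (phi : T -> R)
    r x : phi @ F --> r ->
  hn (rscale (phi t) x - rscale r x) @[t --> F] --> (0 : R).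
Proof.
move=> /subr_cvg0/cvg_norm; rewrite normr0 => phi0.
under eq_fun do rewrite -rscaleBl hnormZ.
by rewrite -(mul0r (hn x)); exact: cvgMr_tmp.
Qed.

End RealInnerProduct.

Section SimpleFunctions.
Import HBSimple.
Context (d : measure_display) (T : measurableType d).

Definition simple_fun (U : Type) (s : T -> U) : Prop :=
  finite_set (range s) /\ forall y, measurable (s @^-1` [set y]).

Lemma simple_map2 (U V W : Type) (op : U -> V -> W) (s1 : T -> U)
    (s2 : T -> V) :
  simple_fun s1 -> simple_fun s2 -> simple_fun (fun t => op (s1 t) (s2 t)).
Proof.
move=> [f1 m1] [f2 m2]; split => [|y].
  apply: (sub_finite_set _ (finite_image2 op f1 f2)) => _ [t _ <-] /=.
  by exists (s1 t); [exists t|exists (s2 t); [exists t|]].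
rewrite (_ : _ @^-1` _ = \bigcup_(p in (range s1 `*` range s2) `&`
    [set p | op p.1 p.2 = y]) (s1 @^-1` [set p.1] `&` s2 @^-1` [set p.2])).
  apply: fin_bigcup_measurable => [|p _]; last exact: measurableI.
  exact: (sub_finite_set (@subIsetl _ _ _) (finite_setX f1 f2)).
apply/seteqP; split => [t /= <-|t [[p1 p2] /= [_ <-] [-> ->]]//].
by exists (s1 t, s2 t) => //=; split => //; split; exists t.
Qed.

Lemma simple_cst (U : Type) (y : U) : simple_fun (fun _ => y).
Proof.
split => [|z].
  by apply: (sub_finite_set _ (finite_set1 y)) => _ [t _ <-].
have [->|yz] := pselect (y = z).
  by rewrite (_ : _ @^-1` _ = setT) //; apply/seteqP; split.
by rewrite (_ : _ @^-1` _ = set0) //; apply/seteqP; split.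
Qed.

Lemma simple_map (U V : Type) (op : U -> V) (s : T -> U) :
  simple_fun s -> simple_fun (op \o s).
Proof.
by move=> ss; exact: (simple_map2 (fun x _ => op x) ss (simple_cst tt)).
Qed.

Lemma simple_measurable_fun (d' : measure_display) (U : measurableType d')
    (s : T -> U) :
  simple_fun s -> measurable_fun setT s.
Proof.
move=> [fs ms] _ Y mY; rewrite setTI.
rewrite (_ : _ @^-1` _ = \bigcup_(y in range s `&` Y) (s @^-1` [set y])).
  apply: fin_bigcup_measurable => //.
  exact: (sub_finite_set (@subIsetl _ _ _) fs).
apply/seteqP; split => [t /= Yt|t [y [_ Yy] /= ->]//].
by exists (s t) => //; split => //; exists t.
Qed.

Lemma measurable_fun_simple_approx (R : realType) (f : T -> R) :
  measurable_fun setT f ->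
  exists s : nat -> T -> R, (forall n, simple_fun (s n)) /\
    forall t, s ^~ t @ \oo --> f t.
Proof.
move=> mf; have mEf : measurable_fun setT (EFin \o f).
  exact: measurableT_comp.
have [g cg] := approximation_sfun measurableT mEf.
exists (fun n => g n); split=> [n|t].
  by split=> [|y]; [exact: fimfunP|exact: measurable_funPTI].
by have /fine_cvgP [_] := cg t I.
Qed.

End SimpleFunctions.

Section StronglyMeasurable.
Context (R : realType) (b : bool) (H : lmodType (scal R b)).
Context (ip : H -> H -> scal R b) (hH : is_hilbert ip).
Local Notation hn := (hnorm ip).
Implicit Types (f g : R -> H) (phi : R -> R).

Lemma simple_smeas f : simple_fun f -> smeas ip f.
Proof.
move=> sf; exists (fun=> f); split => // t.
by under eq_fun do rewrite subrr (hnorm0 hH); exact: cvg_cst.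
Qed.

Lemma smeasD f g : smeas ip f -> smeas ip g -> smeas ip (fun t => f t + g t).
Proof.
move=> [s [ss cs]] [s' [ss' cs']].
exists (fun n t => s n t + s' n t); split => [n|t].
  exact: (simple_map2 +%R (ss n) (ss' n)).
apply: (cvg_dist_le
    (v := fun n => hn (s n t - f t) + hn (s' n t - g t))) => [n|].
  by rewrite subr0 ger0_norm ?hnorm_ge0 // opprD addrACA ler_hnormD.
by rewrite -[0]addr0; apply: cvgD.
Qed.

Lemma smeas_rscale phi f : measurable_fun setT phi -> smeas ip f ->
  smeas ip (fun t => rscale (phi t) (f t)).
Proof.
move=> /measurable_fun_simple_approx [p [sp cp]] [s [ss cs]].
exists (fun n t => rscale (p n t) (s n t)); split => [n|t].
  exact: (simple_map2 (@rscale R b H) (sp n) (ss n)).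
apply: (cvg_dist_le (v := fun n => `|p n t| * hn (s n t - f t)
    + hn (rscale (p n t) (f t) - rscale (phi t) (f t)))) => [n|].
  rewrite subr0 ger0_norm ?hnorm_ge0 // -hnormZ // rscaleBr.
  by apply: le_trans (ler_hnormD hH _ _); rewrite addrA subrK.
rewrite -[0]addr0; apply: cvgD; last exact: cvg_rscale.
by rewrite -(mulr0 `|phi t|); apply: cvgM => //; exact: cvg_norm.
Qed.

Lemma smeas_rscale_cst phi (h : H) : measurable_fun setT phi ->
  smeas ip (fun t => rscale (phi t) h).
Proof. by move=> mphi; apply/smeas_rscale/simple_smeas/simple_cst. Qed.

Lemma smeasN f : smeas ip f -> smeas ip (fun t => - f t).
Proof.
move=> mf; under eq_fun do rewrite -rscaleN1.
by apply: smeas_rscale => //; exact: measurable_cst.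
Qed.

Lemma smeasB f g : smeas ip f -> smeas ip g -> smeas ip (fun t => f t - g t).
Proof. by move=> mf mg; apply: smeasD => //; exact: smeasN. Qed.

Lemma measurable_hnorm f : smeas ip f ->
  measurable_fun setT (fun t => hn (f t)).
Proof.
move=> [s [ss cs]].
apply: (@measurable_fun_cvg _ _ _ _ (fun n t => hn (s n t))) => [n|t _].
  exact: simple_measurable_fun (simple_map hn (ss n)).
by apply: cvg_dist_le (cs t) => n; exact: ler_dist_hnorm.
Qed.

Lemma measurable_rip f g : smeas ip f -> smeas ip g ->
  measurable_fun setT (fun t => rip ip (f t) (g t)).
Proof.
move=> mf mg; under eq_fun do rewrite (rip_polarization hH).
apply: measurable_funM; last exact: measurable_cst.
apply: measurable_funB; apply: measurable_funX; apply: measurable_hnorm.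
  exact: smeasD.
exact: smeasB.
Qed.

End StronglyMeasurable.

Section WeightedL2.
Context (R : realType) (b : bool) (H : lmodType (scal R b)).
Context (ip : H -> H -> scal R b) (hH : is_hilbert ip).
Local Notation hn := (hnorm ip).
Local Notation mu := (@lebesgue_measure R).
Local Notation L2w := (L2w ip).
Local Notation wnorm := (wnorm ip).
Implicit Types (f g h : R -> H) (rho sigma tau r t : R).

Definition weight rho t : R := expR (- (rho * t)).

Lemma weight_gt0 rho t : 0 < weight rho t.
Proof. exact: expR_gt0. Qed.

Lemma weightD rho sigma t :
  weight (rho + sigma) t = weight rho t * weight sigma t.
Proof. by rewrite /weight mulrDl opprD expRD. Qed.

Lemma weightNr rho t : weight (rho - rho) t = 1.
Proof. by rewrite /weight subrr mul0r oppr0 expR0. Qed.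

Lemma measurable_weight rho : measurable_fun setT (weight rho).
Proof.
apply: measurableT_comp; first exact: measurable_expR.
by apply: measurable_funN; exact: measurable_funM.
Qed.

(* The L^2 pairing of H_{rho,0} with H_{sigma,0}: the inner product of
   H_{rho,0} when rho = sigma, the unweighted duality when sigma = - rho. *)
Definition wip rho sigma f g : R :=
  \int[mu]_t (rip ip (f t) (g t) * weight (rho + sigma) t).

Lemma wnorm2E rho f :
  wnorm2 ip rho f = (\int[mu]_t ((hn (f t) * weight rho t) ^+ 2)%:E)%E.
Proof.
apply: eq_integral => t _; congr EFin.
by rewrite exprMn; congr (_ * _); rewrite expr2 -expRD; congr expR; ring.
Qed.

Lemma measurable_sqr_hnorm_weight rho f : smeas ip f ->
  measurable_fun setT (fun t => (hn (f t) * weight rho t) ^+ 2).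
Proof.
move=> mf; apply: measurable_funX; apply: measurable_funM.
  exact: measurable_hnorm.
exact: measurable_weight.
Qed.

Lemma L2wP rho f : L2w rho f <-> smeas ip f /\
  mu.-integrable setT (EFin \o (fun t => (hn (f t) * weight rho t) ^+ 2)).
Proof.
have abs_sqr : wnorm2 ip rho f =
    (\int[mu]_t `|((hn (f t) * weight rho t) ^+ 2)%:E|)%E.
  rewrite wnorm2E; apply: eq_integral => t _.
  by rewrite gee0_abs // lee_fin sqr_ge0.
split=> -[mf] fi; split => //.
  apply/integrableP; split; last by rewrite -abs_sqr.
  by apply/measurable_EFinP; exact: measurable_sqr_hnorm_weight.
by rewrite abs_sqr; case/integrableP: fi.
Qed.

Lemma L2w_smeas rho f : L2w rho f -> smeas ip f.
Proof. by case. Qed.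

Lemma ler_sqr_hnorm_weight rho r x (y : H) t : hn x <= r * hn y ->
  (hn x * weight rho t) ^+ 2 <= r ^+ 2 * (hn y * weight rho t) ^+ 2.
Proof.
move=> xy; rewrite -exprMn mulrA ler_pXn2r ?nnegrE //.
- by rewrite ler_pM2r ?weight_gt0.
- by rewrite mulr_ge0 ?hnorm_ge0 // ltW ?weight_gt0.
- by rewrite mulr_ge0 ?(le_trans _ xy) ?hnorm_ge0 // ltW ?weight_gt0.
Qed.

Lemma L2w_le rho r f g : smeas ip f -> L2w rho g ->
  (forall t, hn (f t) <= r * hn (g t)) -> L2w rho f.
Proof.
move=> mf /L2wP[mg ig] fg; apply/L2wP; split => //.
apply: le_integrable (integrableZl measurableT (r ^+ 2) ig) => //.
  by apply/measurable_EFinP; exact: measurable_sqr_hnorm_weight.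
move=> t _ /=; rewrite lee_fin !ger0_norm ?(sqr_ge0, mulr_ge0) //.
exact: ler_sqr_hnorm_weight.
Qed.

Lemma L2wZ rho r f : L2w rho f -> L2w rho (fun t => rscale r (f t)).
Proof.
move=> lf; apply: (@L2w_le _ `|r| _ f) => // [|t]; last by rewrite hnormZ.
by apply: smeas_rscale => //; exact: L2w_smeas lf.
Qed.

Lemma L2wN rho f : L2w rho f -> L2w rho (fun t => - f t).
Proof. by move=> lf; under eq_fun do rewrite -rscaleN1; exact: L2wZ. Qed.

Lemma L2wD rho f g : L2w rho f -> L2w rho g -> L2w rho (fun t => f t + g t).
Proof.
move=> /L2wP[mf fi] /L2wP[mg gi]; apply/L2wP; split; first exact: smeasD.
have := integrableZl measurableT 2 (integrableD measurableT fi gi).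
apply: le_integrable => //.
  by apply/measurable_EFinP; apply: measurable_sqr_hnorm_weight; exact: smeasD.
move=> t _ /=; rewrite lee_fin !exprMn -mulrDl [2 * _]mulrA.
rewrite !ger0_norm ?(sqr_ge0, addr_ge0, mulr_ge0) //.
rewrite ler_wpM2r ?sqr_ge0 // !hnorm_sqr //.
have := rip_ge0 hH (f t - g t).
by rewrite !(ripDl, ripDr, ripNl, ripNr) // (ripC hH (g t) (f t)); lra.
Qed.

Lemma L2wB rho f g : L2w rho f -> L2w rho g -> L2w rho (fun t => f t - g t).
Proof. by move=> lf lg; exact: L2wD lf (L2wN lg). Qed.

Lemma wip_integrable rho sigma f g : L2w rho f -> L2w sigma g ->
  mu.-integrable setT
    (EFin \o (fun t => rip ip (f t) (g t) * weight (rho + sigma) t)).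
Proof.
move=> /L2wP[mf fi] /L2wP[mg gi].
apply: le_integrable (integrableD measurableT fi gi) => //.
  apply/measurable_EFinP; apply: measurable_funM; last exact: measurable_weight.
  exact: measurable_rip.
move=> t _ /=; rewrite lee_fin [leRHS]ger0_norm ?addr_ge0 ?sqr_ge0 //.
set x := hn (f t) * _; set y := hn (g t) * _.
have xy : `|rip ip (f t) (g t) * weight (rho + sigma) t| <= x * y.
  rewrite normrM (gtr0_norm (weight_gt0 _ _)) weightD /x /y mulrACA.
  by rewrite ler_pM2r ?mulr_gt0 ?weight_gt0 // CauchySchwarz_rip.
apply: le_trans xy _; have := sqr_ge0 (x - y).
by have := sqr_ge0 x; have := sqr_ge0 y; rewrite sqrrB; lra.
Qed.

Lemma wipC rho sigma f g : wip rho sigma f g = wip sigma rho g f.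
Proof. by apply: eq_Rintegral => t _; rewrite ripC // addrC. Qed.

Lemma wipDl rho sigma f f' g : L2w rho f -> L2w rho f' -> L2w sigma g ->
  wip rho sigma (fun t => f t + f' t) g =
  wip rho sigma f g + wip rho sigma f' g.
Proof.
move=> lf lf' lg; rewrite /wip.
under eq_Rintegral do rewrite ripDl // mulrDl.
by apply: RintegralD => //; exact: wip_integrable.
Qed.

Lemma wipZl rho sigma r f g : L2w rho f -> L2w sigma g ->
  wip rho sigma (fun t => rscale r (f t)) g = r * wip rho sigma f g.
Proof.
move=> lf lg; rewrite /wip; under eq_Rintegral do rewrite ripZl // -mulrA.
by apply: RintegralZl => //; exact: wip_integrable.
Qed.

Lemma wipNl rho sigma f g : L2w rho f -> L2w sigma g ->
  wip rho sigma (fun t => - f t) g = - wip rho sigma f g.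
Proof.
move=> lf lg; rewrite -mulN1r -wipZl //.
by under [in RHS]eq_fun do rewrite rscaleN1.
Qed.

Lemma wipBl rho sigma f f' g : L2w rho f -> L2w rho f' -> L2w sigma g ->
  wip rho sigma (fun t => f t - f' t) g =
  wip rho sigma f g - wip rho sigma f' g.
Proof.
by move=> lf lf' lg; rewrite (wipDl lf (L2wN lf') lg) (wipNl lf' lg).
Qed.

Lemma wipDr rho sigma f g g' : L2w rho f -> L2w sigma g -> L2w sigma g' ->
  wip rho sigma f (fun t => g t + g' t) =
  wip rho sigma f g + wip rho sigma f g'.
Proof.
by move=> lf lg lg'; rewrite wipC (wipDl lg lg' lf) !(wipC sigma).
Qed.

Lemma wipZr rho sigma r f g : L2w rho f -> L2w sigma g ->
  wip rho sigma f (fun t => rscale r (g t)) = r * wip rho sigma f g.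
Proof. by move=> lf lg; rewrite wipC (wipZl r lg lf) wipC. Qed.

Lemma wipNr rho sigma f g : L2w rho f -> L2w sigma g ->
  wip rho sigma f (fun t => - g t) = - wip rho sigma f g.
Proof. by move=> lf lg; rewrite wipC (wipNl lg lf) wipC. Qed.

Lemma wipBr rho sigma f g g' : L2w rho f -> L2w sigma g -> L2w sigma g' ->
  wip rho sigma f (fun t => g t - g' t) =
  wip rho sigma f g - wip rho sigma f g'.
Proof.
by move=> lf lg lg'; rewrite wipC (wipBl lg lg' lf) !(wipC sigma).
Qed.

Lemma wip_ge0 rho f : 0 <= wip rho rho f f.
Proof.
by apply: Rintegral_ge0 => t _; rewrite mulr_ge0 ?rip_ge0 // ltW ?weight_gt0.
Qed.

Lemma wnormE rho f : wnorm rho f = Num.sqrt (wip rho rho f f).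
Proof.
rewrite /wnorm wnorm2E; congr Num.sqrt; apply: eq_Rintegral => t _.
by rewrite exprMn hnorm_sqr // weightD -expr2.
Qed.

Lemma wnorm_sqr rho f : wnorm rho f ^+ 2 = wip rho rho f f.
Proof. by rewrite wnormE sqr_sqrtr // wip_ge0. Qed.

Lemma wnorm_ge0 rho f : 0 <= wnorm rho f.
Proof. exact: sqrtr_ge0. Qed.

Lemma wnormN rho f : wnorm rho (fun t => - f t) = wnorm rho f.
Proof.
by rewrite !wnormE; congr Num.sqrt; apply: eq_Rintegral => t _;
  rewrite ripNl // ripNr // opprK.
Qed.

Lemma wnorm_cst0 rho : wnorm rho (fun=> 0) = 0.
Proof.
rewrite wnormE (_ : wip _ _ _ _ = 0) ?sqrtr0 // /wip /Rintegral.
by rewrite integral0_eq // => t _; rewrite -hnorm_sqr // hnorm0 // expr0n mul0r.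
Qed.

Definition reweight rho sigma f : R -> H :=
  fun t => rscale (weight (rho - sigma) t) (f t).

Lemma L2w_reweight rho sigma f : L2w rho f -> L2w sigma (reweight rho sigma f).
Proof.
move=> /L2wP[mf fi]; apply/L2wP; split.
  by apply: smeas_rscale => //; exact: measurable_weight.
apply: eq_integrable fi => // t _ /=; congr (_ ^+ 2)%:E.
rewrite hnormZ // (gtr0_norm (weight_gt0 _ _)) mulrAC -weightD subrK.
exact: mulrC.
Qed.

Lemma wip_reweightr rho sigma tau f g :
  wip tau sigma f (reweight rho sigma g) = wip tau rho f g.
Proof.
apply: eq_Rintegral => t _; rewrite ripZr // mulrAC -weightD mulrC.
by congr (_ * weight _ t); ring.
Qed.

Lemma wip_reweightl rho sigma tau f g :
  wip sigma tau (reweight rho sigma f) g = wip rho tau f g.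
Proof. by rewrite wipC wip_reweightr wipC. Qed.

Lemma wnorm_reweight rho sigma f :
  wnorm sigma (reweight rho sigma f) = wnorm rho f.
Proof. by rewrite !wnormE wip_reweightl wip_reweightr. Qed.

Lemma CauchySchwarz_wip rho sigma f g : L2w rho f -> L2w sigma g ->
  `|wip rho sigma f g| <= wnorm rho f * wnorm sigma g.
Proof.
move=> lf lg; rewrite -(wip_reweightr sigma rho) -(wnorm_reweight sigma rho).
have {lg} := L2w_reweight rho lg; move: (reweight _ _ g) => {}g lg.
rewrite -sqrtr_sqr !wnormE -sqrtrM ?wip_ge0 //.
apply: ler_wsqrtr; apply: quadratic_ge0_sqr_le => s.
have lsf := L2wZ s lf.
have := wip_ge0 rho (fun t => rscale s (f t) + g t).
rewrite wipDl ?wipDr ?wipZl ?wipZr //; last exact: L2wD.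
by rewrite ?wipZl // (wipC _ _ g f); lra.
Qed.

Lemma ler_wnormD rho f g : L2w rho f -> L2w rho g ->
  wnorm rho (fun t => f t + g t) <= wnorm rho f + wnorm rho g.
Proof.
move=> lf lg; have := le_trans (ler_norm _) (CauchySchwarz_wip lf lg) => CS.
rewrite -(@ler_pXn2r _ 2) ?nnegrE ?addr_ge0 ?wnorm_ge0 //.
rewrite sqrrD !wnorm_sqr (wipDl lf lg (L2wD lf lg)) !wipDr // (wipC _ _ g f).
by lra.
Qed.

Lemma wnorm_distrC rho f g :
  wnorm rho (fun t => f t - g t) = wnorm rho (fun t => g t - f t).
Proof. by rewrite -wnormN; under eq_fun do rewrite opprB. Qed.

Lemma ler_wnorm_distD rho g f h : L2w rho f -> L2w rho g -> L2w rho h ->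
  wnorm rho (fun t => f t - h t) <=
  wnorm rho (fun t => f t - g t) + wnorm rho (fun t => g t - h t).
Proof.
move=> lf lg lh; apply: le_trans (ler_wnormD (L2wB lf lg) (L2wB lg lh)).
by under [in leRHS]eq_fun do rewrite addrA subrK.
Qed.

Lemma ler_dist_wnorm rho f g : L2w rho f -> L2w rho g ->
  `|wnorm rho f - wnorm rho g| <= wnorm rho (fun t => f t - g t).
Proof.
have subadd f' g' : L2w rho f' -> L2w rho g' ->
    wnorm rho f' <= wnorm rho (fun t => f' t - g' t) + wnorm rho g'.
  move=> lf' lg'; have := ler_wnormD (L2wB lf' lg') lg'.
  by under [in leLHS]eq_fun do rewrite subrK.
move=> lf lg; have := subadd _ _ lg lf; have := subadd _ _ lf lg.
rewrite (wnorm_distrC _ g f) ler_norml.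
by do 3!move: (wnorm rho _) => ?; lra.
Qed.

End WeightedL2.

Section WeightedL2Convergence.
Context (R : realType) (b : bool) (H : lmodType (scal R b)).
Context (ip : H -> H -> scal R b) (hH : is_hilbert ip).
Local Notation hn := (hnorm ip).
Local Notation mu := (@lebesgue_measure R).
Local Notation L2w := (L2w ip).
Local Notation wnorm := (wnorm ip).
Implicit Types (f g : R -> H) (fs gs : nat -> R -> H) (rho sigma : R).

Definition wcvg rho fs f : Prop :=
  wnorm rho (fun t => fs n t - f t) @[n --> \oo] --> (0 : R).

Lemma wcvgB rho fs gs f g : (forall n, L2w rho (fs n)) ->
    (forall n, L2w rho (gs n)) -> L2w rho f -> L2w rho g ->
  wcvg rho fs f -> wcvg rho gs g ->
  wcvg rho (fun n t => fs n t - gs n t) (fun t => f t - g t).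
Proof.
move=> lfs lgs lf lg ff gg.
apply: (cvg_dist_le (v := fun n => wnorm rho (fun t => fs n t - f t)
    + wnorm rho (fun t => gs n t - g t))) => [n|]; last first.
  by rewrite -[X in _ --> X]addr0; apply: cvgD.
rewrite subr0 ger0_norm ?wnorm_ge0 // -(wnormN hH _ (fun t => gs n t - g t)).
under eq_fun do rewrite opprD addrACA -opprD.
exact: ler_wnormD (L2wB hH (lfs n) lf) (L2wN hH (L2wB hH (lgs n) lg)).
Qed.

Lemma wcvg_wnorm rho fs f : (forall n, L2w rho (fs n)) -> L2w rho f ->
  wcvg rho fs f -> wnorm rho (fs n) @[n --> \oo] --> wnorm rho f.
Proof.
by move=> lfs lf; apply: cvg_dist_le => n; exact: ler_dist_wnorm.
Qed.

Lemma wcvg_wip rho sigma f gs g : L2w rho f -> (forall n, L2w sigma (gs n)) ->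
    L2w sigma g -> wcvg sigma gs g ->
  wip ip rho sigma f (gs n) @[n --> \oo] --> wip ip rho sigma f g.
Proof.
move=> lf lgs lg gg; apply: (cvg_dist_le (v := fun n =>
    wnorm rho f * wnorm sigma (fun t => gs n t - g t))) => [n|].
  rewrite -(wipBr hH lf (lgs n) lg).
  exact: CauchySchwarz_wip lf (L2wB hH (lgs n) lg).
by rewrite -(mulr0 (wnorm rho f)); exact: cvgMl_tmp.
Qed.

Lemma wcvg_dominated rho fs f g r : (forall n, smeas ip (fs n)) ->
    smeas ip f -> L2w rho g ->
  (forall n t, hn (fs n t - f t) <= r * hn (g t)) ->
  (forall t, hn (fs n t - f t) @[n --> \oo] --> (0 : R)) -> wcvg rho fs f.
Proof.
move=> mfs mf /L2wP-/(_ hH)[mg ig] le_g cv.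
have [] := @dominated_convergence _ _ R mu setT measurableT
  (fun n t => ((hn (fs n t - f t) * weight rho t) ^+ 2)%:E)
  (cst 0%E) (fun t => ((r ^+ 2)%:E * ((hn (g t) * weight rho t) ^+ 2)%:E)%E).
- move=> n; apply/measurable_EFinP; apply: measurable_sqr_hnorm_weight => //.
  exact: smeasB.
- exact: measurable_cst.
- apply: aeW => t _; apply: cvg_EFin; first exact: nearW.
  suff : (hn (fs n t - f t) * weight rho t) ^+ 2 @[n --> \oo] -->
      (0 * weight rho t) ^+ 2 by rewrite mul0r expr0n.
  by apply: cvgM; exact: cvgMr_tmp.
- exact: integrableZl.
- apply: aeW => t n _; rewrite /= lee_fin ger0_norm ?sqr_ge0 //.
  exact: ler_sqr_hnorm_weight.
move=> _ _; rewrite integral0 => /fine_cvgP[_ cv0].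
rewrite /wcvg -(@sqrtr0 R) /wnorm; under eq_fun do rewrite wnorm2E.
by apply: continuous_cvg cv0; exact: sqrt_continuous.
Qed.

End WeightedL2Convergence.

Section CompactSupport.
Context (R : realType).
Local Notation mu := (@lebesgue_measure R).
Implicit Types (f g phi : R -> R).

Definition supported_in (V : zmodType) (M : R) (u : R -> V) : Prop :=
  forall t, M < `|t| -> u t = 0.

Definition compactly_supported (V : zmodType) (u : R -> V) : Prop :=
  exists M, supported_in M u.

Lemma compactly_supported_pos (V : zmodType) (u : R -> V) :
  compactly_supported u -> exists2 M, 0 < M & supported_in M u.
Proof.
move=> [M uM]; exists (`|M| + 1) => [|t Mt]; first by rewrite ltr_wpDl.
by apply: uM; have := ler_norm M; lra.
Qed.

Lemma compactly_supported_itv (V : zmodType) (u : R -> V) (p q : R) :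
  (forall t, ~~ (p < t < q) -> u t = 0) -> compactly_supported u.
Proof.
move=> u0; exists (Num.max `|p| `|q|) => t; rewrite gt_max => /andP[pt qt].
apply: u0; apply/negP; move: pt qt.
have := ler_norm q; have := ler_norm (- p); rewrite normrN.
by case: (ger0P t) => t0 ? ? ? ? /andP[? ?]; lra.
Qed.

Lemma supported_in_patch M f : supported_in M f -> f \_ `[- M, M] = f.
Proof.
move=> f0; apply/funext => t; rewrite patchE; case: ifPn => //.
by rewrite notin_setE /= in_itv /= => /negP; rewrite -ler_norml -ltNge => /f0.
Qed.

Lemma integrable_compactly_supported f : measurable_fun setT f ->
  (exists C, forall t, `|f t| <= C) -> compactly_supported f ->
  mu.-integrable setT (EFin \o f).
Proof.
move=> mf [C fC] [M /supported_in_patch fE].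
have : mu.-integrable `[- M, M] (EFin \o f).
  apply: measurable_bounded_integrable => //.
  - by rewrite /= lebesgue_measure_itv /=; case: ifP; rewrite ?ltry.
  - exact: measurable_funTS.
  - exists C; split=> [|D CD t _]; first exact: num_real.
    exact: le_trans (fC t) (ltW CD).
by move=> /integrable_mkcond -/(_ (measurable_itv _)); rewrite restrict_EFin fE.
Qed.

Lemma continuous_compactly_supported_bounded phi : continuous phi ->
  compactly_supported phi -> exists C, forall t, `|phi t| <= C.
Proof.
move=> cphi /compactly_supported_pos[M M0 phi0].
have MM : - M <= M by rewrite ge0_cp ?ltW.
have cn : {within `[- M, M], continuous (fun t => `|phi t|)}.
  by apply: continuous_subspaceT => t; apply: cvg_norm; exact: cphi.
have [c _ hc] := EVT_max MM cn.
exists `|phi c| => t; have [tM|/phi0 ->] := leP `|t| M.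
  by apply: hc; rewrite in_itv /= -ler_norml.
by rewrite normr0.
Qed.

Lemma continuous_compactly_supported_integrable phi : continuous phi ->
  compactly_supported phi -> mu.-integrable setT (EFin \o phi).
Proof.
move=> cphi sphi; apply: integrable_compactly_supported => //.
  exact: continuous_measurable_fun.
exact: continuous_compactly_supported_bounded.
Qed.

Lemma compactly_supportedMr f g :
  compactly_supported g -> compactly_supported (fun t => f t * g t).
Proof. by move=> [M g0]; exists M => t /g0 ->; rewrite mulr0. Qed.

End CompactSupport.

Section ContinuouslyDerivable.
Context (R : realType).
Local Notation mu := (@lebesgue_measure R).
Implicit Types (phi psi : R -> R).

Lemma derivable_continuous phi :
  (forall t, derivable phi t 1) -> continuous phi.
Proof.
by move=> dphi t; apply: differentiable_continuous; exact/derivable1_diffP.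
Qed.

Lemma supported_in_derive1 M phi :
  supported_in M phi -> supported_in M (derive1 phi).
Proof.
move=> phi0 t Mt; rewrite derive1E.
rewrite (@near_eq_derive _ _ _ phi (cst 0)) ?derive_cst //.
near=> s; apply: phi0; near: s.
have : continuous (fun s : R => `|s|) by exact: norm_continuous.
by move=> /(_ t) /cvgr_gt; apply.
Unshelve. all: by end_near. Qed.

Lemma compactly_supported_derive1 phi :
  compactly_supported phi -> compactly_supported (derive1 phi).
Proof. by move=> [M phi0]; exists M; exact: supported_in_derive1. Qed.

Definition C1_fun phi : Prop :=
  (forall t, derivable phi t 1) /\ continuous (derive1 phi).

Definition C1c_fun phi : Prop := C1_fun phi /\ compactly_supported phi.

Lemma C1_continuous phi : C1_fun phi -> continuous phi.
Proof. by move=> [/derivable_continuous]. Qed.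

Lemma is_derive_C1 phi phi' : (forall t, is_derive t (1 : R) phi (phi' t)) ->
  continuous phi' -> C1_fun phi.
Proof.
move=> dphi cphi'; split=> [t|]; first by have [] := dphi t.
rewrite (_ : derive1 phi = phi') //; apply/funext => t.
by rewrite derive1E; have [] := dphi t.
Qed.

Lemma is_derive1M phi psi t : derivable phi t 1 -> derivable psi t 1 ->
  is_derive t (1 : R) (fun s => phi s * psi s)
    (phi t * derive1 psi t + derive1 phi t * psi t).
Proof.
move=> dphi dpsi; have := is_deriveM (derivableP dphi) (derivableP dpsi).
by rewrite -!derive1E /GRing.scale /= (mulrC (psi t)).
Qed.

Lemma C1M phi psi : C1_fun phi -> C1_fun psi -> C1_fun (fun t => phi t * psi t).
Proof.
move=> C1phi C1psi; have [[dphi cphi'] [dpsi cpsi']] := (C1phi, C1psi).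
apply: is_derive_C1 (fun t => is_derive1M (dphi t) (dpsi t)) _ => t.
apply: cvgD; apply: cvgM.
- exact: C1_continuous.
- exact: cpsi'.
- exact: cphi'.
- exact: C1_continuous.
Qed.

Lemma is_derive_weight (rho t : R) :
  is_derive t (1 : R) (weight rho) (- rho * weight rho t).
Proof.
have := @is_derive1_comp _ expR (fun s => - (rho * s)) t _ _
  (is_derive_expR _) (is_deriveN (is_deriveZ rho (is_derive_id t (1 : R)))).
by rewrite /GRing.scale /= mulr1 mulrC.
Qed.

Lemma derive1_weight (rho t : R) :
  derive1 (weight rho) t = - rho * weight rho t.
Proof. by rewrite derive1E; have [] := is_derive_weight rho t. Qed.

Lemma C1_weight (rho : R) : C1_fun (weight rho).
Proof.
apply: is_derive_C1 (is_derive_weight rho) _ => t; apply: cvgMl_tmp.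
by apply: derivable_continuous => s; have [] := is_derive_weight rho s.
Qed.

Lemma test_fun_C1c phi : test_fun phi -> C1c_fun phi.
Proof.
move=> [dphi sphi]; split=> //; split; first exact: dphi 0%N.
exact: derivable_continuous (dphi 1%N).
Qed.

Lemma C1_derivable_oo_LRcontinuous phi (x y : R) : C1_fun phi ->
  derivable_oo_LRcontinuous phi x y.
Proof.
move=> C1phi; have cphi := C1_continuous C1phi.
split=> [t _||]; first exact: C1phi.1.
  exact/cvg_at_right_filter/cphi.
exact/cvg_at_left_filter/cphi.
Qed.

Lemma Rintegration_by_parts_C1c phi psi : C1_fun phi -> C1c_fun psi ->
  \int[mu]_t (phi t * derive1 psi t) = - \int[mu]_t (derive1 phi t * psi t).
Proof.
move=> C1phi [C1psi [M psi0]]; pose N := `|M| + 1.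
have [N0 MN] : 0 < N /\ M < N.
  by rewrite /N; have := ler_norm M; have := normr_ge0 M; lra.
have restrict f g : supported_in M g ->
    \int[mu]_t (f t * g t) = \int[mu]_(t in `[- N, N]) (f t * g t).
  move=> g0; rewrite [RHS]Rintegral_mkcond supported_in_patch // => t Nt.
  by rewrite g0 ?mulr0 ?(lt_trans MN).
rewrite !restrict //; last exact: supported_in_derive1.
have NN : - N < N by rewrite gtrN.
rewrite (Rintegration_by_parts NN (continuous_subspaceT C1phi.2)
  (C1_derivable_oo_LRcontinuous _ _ C1phi) _ (continuous_subspaceT C1psi.2)
  (C1_derivable_oo_LRcontinuous _ _ C1psi)) //.
by rewrite !psi0 ?normrN ?gtr0_norm // !mulr0 subrr sub0r.
Qed.

End ContinuouslyDerivable.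

Section BumpFunctions.
Context (R : realType).
Implicit Types (c p q t x y : R) (P : {poly R}) (f g : R -> R).

Lemma exprn_le_expR n c y : 0 < c -> 0 <= y ->
  y ^+ n <= n`!%:R / c ^+ n * expR (c * y).
Proof.
move=> c0 y0; have cy0 : 0 <= c * y by rewrite mulr_ge0 // ltW.
rewrite mulrAC ler_pdivlMr ?exprn_gt0 // [leLHS]mulrC [leRHS]mulrC -exprMn.
rewrite -ler_pdivrMr ?ltr0n ?fact_gt0 //; case: n => [|n].
  by rewrite expr0 fact0 divr1 -[leLHS]expR0 ler_expR.
by apply: le_trans (expR_ge1Dxn n cy0); rewrite lerDr.
Qed.

Lemma horner_le_expR P c : 0 < c ->
  exists2 M, 0 <= M & forall y, 0 <= y -> `|P.[y]| <= M * expR (c * y).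
Proof.
move=> c0; pose M := \sum_(i < size P) `|P`_i| * (i`!%:R / c ^+ i).
exists M => [|y y0].
  by apply: sumr_ge0 => i _; rewrite mulr_ge0 // divr_ge0 // exprn_ge0 ?ltW.
rewrite horner_coef mulr_suml; apply: le_trans (ler_norm_sum _ _ _) _.
apply: ler_sum => i _; rewrite normrM normrX (ger0_norm y0) -mulrA.
by rewrite ler_wpM2l // exprn_le_expR.
Qed.

(* All derivatives of [exp (- c / x)] at [x > 0] have this shape, and extend by
   [0] to the left of the origin. *)
Definition flat c P x : R :=
  if 0 < x then P.[x^-1] * expR (- (c * x^-1)) else 0.

Lemma flatN c P x : flat c (- P) x = - flat c P x.
Proof. by rewrite /flat; case: ifP; rewrite ?oppr0 // hornerN mulNr. Qed.

Lemma flat_le_sqr c P : 0 < c ->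
  exists M, forall x, `|flat c P x| <= M * x ^+ 2.
Proof.
move=> c0; have [M M0 hM] := horner_le_expR ('X^2 * P) c0.
exists M => x; rewrite /flat; case: ifPn => [x0|_]; last first.
  by rewrite normr0 mulr_ge0 ?sqr_ge0.
have := hM x^-1; rewrite invr_ge0 ltW // => /(_ isT).
rewrite hornerM hornerXn normrM ger0_norm ?sqr_ge0 // exprVn => PM.
rewrite normrM (gtr0_norm (expR_gt0 _)) expRN ler_pdivrMr ?expR_gt0 //.
by rewrite mulrAC mulrC -ler_pdivrMl ?exprn_gt0.
Qed.

Lemma is_derive0_le_sqr f M : (forall x, `|f x| <= M * x ^+ 2) ->
  is_derive (0 : R) (1 : R) f 0.
Proof.
move=> fM; have f0 : f 0 = 0.
  by apply/eqP; have := fM 0; rewrite expr0n mulr0 normr_le0.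
have quotient : h^-1 *: ((f \o shift 0) (h *: (1 : R)) - f 0)
    @[h --> (0 : R)^'] --> (0 : R).
  apply: (cvg_dist_le (v := fun h : R => M * `|h|)) => [h|].
    rewrite /= f0 !subr0 addr0 /GRing.scale /= mulr1 normrM normfV.
    have [->|h0] := eqVneq h 0; first by rewrite normr0 invr0 mul0r mulr0.
    rewrite ler_pdivrMl ?normr_gt0 //; apply: le_trans (fM h) _.
    by rewrite -[h ^+ 2]real_normK ?num_real // expr2 mulrCA.
  suff : M * `|h| @[h --> (0 : R)^'] --> M * `|0 : R| by rewrite normr0 mulr0.
  by apply: cvgMl_tmp; apply: cvg_norm; exact: cvg_within.
split; first by apply/cvg_ex; exists 0.
exact/cvg_lim.
Qed.

Lemma is_derive_flat c P x : 0 < c ->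
  is_derive x 1 (flat c P) (flat c ('X^2 * (c *: P - P^`())) x).
Proof.
move=> c0; rewrite {2}/flat; case: ltgtP => [x0|x0|<-].
- apply: (@near_eq_is_derive _ _ _
      (fun z : R => horner P (z^-1) * expR (- (c * z^-1)))).
    by near=> z; rewrite /flat ifT //; near: z; exact: lt_nbhsr.
  have xn0 : id x != 0 by rewrite gt_eqF.
  have dV := is_deriveV xn0 (is_derive_id x (1 : R)).
  have dP := is_derive1_comp (is_derive_poly P x^-1) dV.
  have dE := @is_derive1_comp _ expR (fun z => - (c * z^-1)) x _ _
    (is_derive_expR _) (is_deriveN (is_deriveZ c dV)).
  apply: is_derive_eq (is_deriveM dP dE) _.
  by rewrite /= !hornerE /GRing.scale /= exprVn; ring.
- apply: (@near_eq_is_derive _ _ _ (cst 0)).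
  near=> z; rewrite /flat ifF //; apply/negbTE; rewrite -leNgt ltW //.
  by near: z; exact: lt_nbhsl.
- by have [M hM] := flat_le_sqr P c0; exact: is_derive0_le_sqr hM.
Unshelve. all: by end_near. Qed.

Inductive flat_algebra c p q : (R -> R) -> Prop :=
| flat_left P : flat_algebra c p q (fun t => flat c P (t - p))
| flat_right P : flat_algebra c p q (fun t => flat c P (q - t))
| flat_algebraD f g : flat_algebra c p q f -> flat_algebra c p q g ->
    flat_algebra c p q (f + g)
| flat_algebraM f g : flat_algebra c p q f -> flat_algebra c p q g ->
    flat_algebra c p q (f * g).

Lemma flat_algebra_derive c p q f : 0 < c -> flat_algebra c p q f ->
  exists2 g, flat_algebra c p q g & forall t, is_derive t (1 : R) f (g t).
Proof.
move=> c0; elim=> [P|P|{}f g Bf [f' Bf' df] Bg [g' Bg' dg]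
  |{}f g Bf [f' Bf' df] Bg [g' Bg' dg]].
- eexists; first exact: (flat_left c p q ('X^2 * (c *: P - P^`()))).
  move=> t; have dt : is_derive t 1 (fun z : R => z - p) 1.
    exact: (is_derive_shift t 1 (- p)).
  have := @is_derive1_comp _ _ _ t _ _ (is_derive_flat P (t - p) c0) dt.
  by rewrite mulr1.
- eexists; first exact: (flat_right c p q (- ('X^2 * (c *: P - P^`())))).
  move=> t; have dt : is_derive t 1 (fun z : R => q - z) (- 1).
    have := is_deriveB (is_derive_cst q t 1) (is_derive_id t (1 : R)).
    by rewrite sub0r.
  have := @is_derive1_comp _ _ _ t _ _ (is_derive_flat P (q - t) c0) dt.
  by rewrite mulrN1 -flatN.
- exists (f' + g') => [|t]; first exact: flat_algebraD.
  exact: is_deriveD.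
- exists (f * g' + g * f') => [|t]; last exact: is_deriveM.
  by apply: flat_algebraD; exact: flat_algebraM.
Qed.

Definition smooth f : Prop := exists Dv : nat -> R -> R,
  Dv 0%N = f /\ forall n t, is_derive t (1 : R) (Dv n) (Dv n.+1 t).

Lemma derive_closed_smooth (A : set (R -> R)) :
  (forall f, A f -> exists2 g, A g & forall t, is_derive t (1 : R) f (g t)) ->
  forall f, A f -> smooth f.
Proof.
move=> Aderive f Af; pose T := {f | A f}.
have /choice [D hD] : forall f : T, exists g : T,
    forall t, is_derive t (1 : R) (sval f) (sval g t).
  by move=> [g Ag]; have [g' Ag' dg] := Aderive _ Ag; exists (exist _ g' Ag').
by exists (fun n => sval (iter n D (exist _ f Af))); split.
Qed.

Definition bump_fun c p q : R -> R :=
  fun t => flat c 1%:P (t - p) * flat c 1%:P (q - t).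

Lemma bump_fun_smooth c p q : 0 < c -> smooth (bump_fun c p q).
Proof.
move=> c0; apply: (@derive_closed_smooth (flat_algebra c p q)) => [f|].
  exact: flat_algebra_derive.
exact: flat_algebraM (flat_left c p q 1%:P) (flat_right c p q 1%:P).
Qed.

Lemma bump_fun_continuous c p q : 0 < c -> continuous (bump_fun c p q).
Proof.
move=> c0; have [Dv [<- dDv]] := bump_fun_smooth p q c0.
by apply: derivable_continuous => t; have [] := dDv 0%N t.
Qed.

Lemma bump_fun_outside c p q t : ~~ (p < t < q) -> bump_fun c p q t = 0.
Proof.
by rewrite /bump_fun /flat !subr_gt0 negb_and => /orP[] /negbTE ->;
  rewrite ?mul0r ?mulr0.
Qed.

Lemma bump_fun_inside c p q t : p < t < q ->
  bump_fun c p q t = expR (- (c * ((t - p)^-1 + (q - t)^-1))).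
Proof.
move=> /andP[pt tq]; rewrite /bump_fun /flat !subr_gt0 pt tq !hornerC !mul1r.
by rewrite -expRD; congr expR; ring.
Qed.

Lemma bump_fun_compactly_supported c p q : compactly_supported (bump_fun c p q).
Proof. exact: compactly_supported_itv (@bump_fun_outside c p q). Qed.

Lemma bump_fun_le_indic c p q t : 0 < c -> `|bump_fun c p q t| <= \1_`]p, q[ t.
Proof.
move=> c0; rewrite indicE.
have [/[dup] pq /andP[pt tq]|out] := boolP (p < t < q).
  rewrite bump_fun_inside // mem_set /= ?in_itv // gtr0_norm ?expR_gt0 //.
  rewrite -[leRHS]expR0 ler_expR oppr_le0.
  by rewrite mulr_ge0 ?addr_ge0 ?invr_ge0 ?subr_ge0 // ltW.
by rewrite bump_fun_outside // normr0.
Qed.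

Lemma bump_fun_cvg p q t :
  bump_fun n.+1%:R^-1 p q t @[n --> \oo] --> (\1_`]p, q[ t : R).
Proof.
rewrite indicE; have [pq|out] := boolP (p < t < q); last first.
  rewrite memNset /= ?in_itv /=; last exact/negP.
  by under eq_fun do rewrite bump_fun_outside //; exact: cvg_cst.
rewrite mem_set /= ?in_itv //; under eq_fun do rewrite bump_fun_inside //.
rewrite -[1%:R]expR0; apply: continuous_cvg; first exact: continuous_expR.
rewrite -oppr0 -(mul0r ((t - p)^-1 + (q - t)^-1)).
by apply: cvgN; apply: cvgMr_tmp; exact: cvg_harmonic.
Qed.

End BumpFunctions.

Section SumIndic.
Context (R : realType) (T : Type) (A : (set T)^nat).
Hypothesis disjA : trivIset setT A.
Implicit Types (n : nat) (t : T).

Lemma sum_indic_cvg t :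
  \sum_(0 <= k < n) \1_(A k) t @[n --> \oo] --> (\1_(\bigcup_k A k) t : R).
Proof.
suff /fine_cvgP[_] : (\sum_(0 <= k < n) \1_(A k) t)%:E @[n --> \oo] -->
  (\1_(\bigcup_k A k) t : R)%:E by [].
rewrite indic_bigcup //; under eq_fun do rewrite -sumEFin.
by apply: is_cvg_nneseries => k _ _; rewrite lee_fin.
Qed.

Lemma sum_indic_le n t :
  \sum_(0 <= k < n) \1_(A k) t <= (\1_(\bigcup_k A k) t : R).
Proof.
rewrite -lee_fin indic_bigcup // -sumEFin; apply: nneseries_lim_ge => k _ _.
by rewrite lee_fin.
Qed.

End SumIndic.

Section CompactlySupportedL2w.
Context (R : realType) (b : bool) (H : lmodType (scal R b)).
Context (ip : H -> H -> scal R b) (hH : is_hilbert ip).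
Local Notation hn := (hnorm ip).
Local Notation L2w := (L2w ip).
Implicit Types (f : R -> H) (fs : nat -> R -> H) (p q : R).
Implicit Types (phi psi : R -> R) (h : H).

Lemma L2w_compactly_supported rho f : smeas ip f ->
  (exists C, forall t, hn (f t) <= C) -> compactly_supported f -> L2w rho f.
Proof.
move=> mf [C fC] /compactly_supported_pos[M M0 f0].
have C0 : 0 <= C := le_trans (hnorm_ge0 ip (f 0)) (fC 0).
apply/L2wP => //; split=> //; apply: integrable_compactly_supported.
- exact: measurable_sqr_hnorm_weight.
- exists ((C * expR (`|rho| * M)) ^+ 2) => t; rewrite ger0_norm ?sqr_ge0 //.
  have [tM|/f0 ->] := leP `|t| M; last first.
    by rewrite hnorm0 // mul0r expr0n sqr_ge0.
  have weightM : weight rho t <= expR (`|rho| * M).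
    rewrite ler_expR; apply: le_trans (ler_norm _) _.
    by rewrite normrN normrM ler_wpM2l.
  by rewrite ler_pXn2r ?nnegrE ?mulr_ge0 ?ler_pM ?hnorm_ge0 ?expR_ge0.
- by exists M => t /f0 ->; rewrite hnorm0 // mul0r expr0n.
Qed.

Lemma L2w_rscale_compactly_supported rho phi h : measurable_fun setT phi ->
    (exists C, forall t, `|phi t| <= C) -> compactly_supported phi ->
  L2w rho (fun t => rscale (phi t) h).
Proof.
move=> mphi [C phiC] [M phi0]; apply: L2w_compactly_supported.
- exact: smeas_rscale_cst.
- by exists (C * hn h) => t; rewrite hnormZ // ler_wpM2r ?hnorm_ge0.
- by exists M => t /phi0 ->; rewrite rscale0.
Qed.

Lemma L2w_rscale_continuous rho phi h : continuous phi ->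
  compactly_supported phi -> L2w rho (fun t => rscale (phi t) h).
Proof.
move=> cphi sphi; apply: L2w_rscale_compactly_supported => //.
  exact: continuous_measurable_fun.
exact: continuous_compactly_supported_bounded.
Qed.

Lemma L2w_rscale_indic_itv rho p q h :
  L2w rho (fun t => rscale (\1_`]p, q[ t) h).
Proof.
apply: L2w_rscale_compactly_supported => //.
  by exists 1 => t; rewrite ger0_norm // indicE; case: (_ \in _).
apply: (@compactly_supported_itv _ _ _ p q) => t pqt.
by rewrite indicE memNset //= in_itv /=; exact/negP.
Qed.

Lemma L2w_rscale_le rho phi psi h : measurable_fun setT phi ->
  (forall t, `|phi t| <= psi t) -> L2w rho (fun t => rscale (psi t) h) ->
  L2w rho (fun t => rscale (phi t) h).
Proof.
move=> mphi phi_psi lpsi.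
apply: (L2w_le hH (r := 1) _ lpsi) => [|t]; first exact: smeas_rscale_cst.
rewrite mul1r !hnormZ // ler_wpM2r ?hnorm_ge0 //.
exact: le_trans (phi_psi t) (ler_norm _).
Qed.

Lemma wcvg_rscale_dominated rho (phis : nat -> R -> R) phi psi h :
    (forall n, measurable_fun setT (phis n)) -> measurable_fun setT phi ->
    (forall n t, `|phis n t| <= psi t) -> (forall t, `|phi t| <= psi t) ->
    L2w rho (fun t => rscale (psi t) h) ->
    (forall t, phis n t @[n --> \oo] --> phi t) ->
  wcvg ip rho (fun n t => rscale (phis n t) h) (fun t => rscale (phi t) h).
Proof.
move=> mphis mphi phis_psi phi_psi lpsi cv.
apply: (wcvg_dominated hH (r := 2) _ _ lpsi).
- by move=> n; exact: smeas_rscale_cst.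
- exact: smeas_rscale_cst.
- move=> n t; rewrite -rscaleBl !hnormZ // mulrA ler_wpM2r ?hnorm_ge0 //.
  apply: le_trans (ler_normB _ _) _.
  by have := ler_norm (psi t); have := phis_psi n t; have := phi_psi t; lra.
- by move=> t; exact: cvg_rscale.
Qed.

(* Truncating the simple approximants of [f] to where they are bounded by
   [2 |f|], and to a bounded interval, makes them dominated by [f]. *)
Lemma L2w_simple_approx rho f : L2w rho f -> exists fs, [/\
  forall n, simple_fun (fs n), forall n, compactly_supported (fs n) &
  wcvg ip rho fs f].
Proof.
move=> lf; have mf := L2w_smeas lf; have [s [ss cs]] := mf.
pose test n t := (hn (s n t) <= 2 * hn (f t)) && (`|t| <= n%:R).
pose trunc n t := if test n t then s n t else 0.
have mtest n : measurable_fun setT (test n).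
  apply: measurable_and; apply: measurable_fun_ler => //.
    exact: simple_measurable_fun (simple_map hn (ss n)).
  by apply: measurable_funM => //; exact: measurable_hnorm.
have simple_trunc n : simple_fun (trunc n).
  apply: (simple_map2 (fun (y : bool) (h : H) => if y then h else 0) _ (ss n)).
  split=> [|y]; first exact: finite_finset.
  by rewrite -[X in measurable X]setTI; apply: mtest.
exists trunc; split=> // [n|].
  by exists n%:R => t nt; rewrite /trunc /test [`|t| <= _]leNgt nt andbF.
apply: (wcvg_dominated hH (r := 3) _ mf lf).
- by move=> n; exact: simple_smeas.
- move=> n t; rewrite /trunc /test; case: ifPn => [/andP[s2f _]|_].
    by have := ler_hnormB hH (s n t) (f t); lra.
  by rewrite sub0r (hnorm_opp hH); have := hnorm_ge0 ip (f t); lra.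
- move=> t; have [/(hnorm_eq0 hH) ft0|ft0] := eqVneq (hn (f t)) 0.
    have trunc0 n : trunc n t = 0.
      rewrite /trunc /test ft0 hnorm0 // mulr0; case: ifPn => // /andP[s0 _].
      by apply: (hnorm_eq0 hH); apply/eqP; rewrite eq_le s0 hnorm_ge0.
    under eq_fun do rewrite trunc0 ft0 subrr hnorm0 //.
    exact: cvg_cst.
  have fpos : 0 < hn (f t) by rewrite lt_neqAle eq_sym ft0 hnorm_ge0.
  apply: cvg_trans (cs t); apply: near_eq_cvg; near=> n.
  rewrite /trunc /test ifT //; apply/andP; split; last first.
    by near: n; exact: nbhs_infty_ger.
  have : hn (s n t - f t) < hn (f t).
    by near: n; exact: (cvgr_lt 0 (cs t)).
  by have := ler_hnormD hH (s n t - f t) (f t); rewrite subrK; lra.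
Unshelve. all: by end_near. Qed.

End CompactlySupportedL2w.

Section L2wInduction.
Context (R : realType) (b : bool) (H : lmodType (scal R b)).
Context (ip : H -> H -> scal R b) (hH : is_hilbert ip).
Local Notation L2w := (L2w ip).
Implicit Types (f g s : R -> H) (fs : nat -> R -> H) (p q : R).
Implicit Types (phi : R -> R) (h : H) (A : set R).
Variables (rho : R) (P : set (R -> H)).
Hypothesis P_itv : forall p q h, P (fun t => rscale (\1_`]p, q[ t) h).
Hypothesis P_add : forall f g, P f -> P g -> P (fun t => f t + g t).
Hypothesis P_lim : forall fs f, (forall n, P (fs n)) -> L2w rho f ->
  wcvg ip rho fs f -> P f.

Lemma L2w_ind_rscale_dominated (phis : nat -> R -> R) phi h p q :
  (forall n, measurable_fun setT (phis n)) ->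
  (forall n t, `|phis n t| <= \1_`]p, q[ t) ->
  (forall t, phis n t @[n --> \oo] --> phi t) ->
  (forall n, P (fun t => rscale (phis n t) h)) ->
  P (fun t => rscale (phi t) h).
Proof.
move=> mphis phis1 cv Pphis.
have mphi : measurable_fun setT phi by apply: measurable_fun_cvg mphis _.
have phi1 t : `|phi t| <= \1_`]p, q[ t.
  apply: (ler_cvg_to (cvg_norm (cv t)) (cvg_cst _)).
  by apply: nearW => n; exact: phis1.
have l1 := L2w_rscale_indic_itv hH rho p q h.
apply: P_lim Pphis (L2w_rscale_le hH mphi phi1 l1) _.
exact: wcvg_rscale_dominated l1 cv.
Qed.

Lemma L2w_ind_sum (I : eqType) (r : seq I) (fs : I -> R -> H) :
  (forall i, i \in r -> P (fs i)) -> P (fun t => \sum_(i <- r) fs i t).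
Proof.
elim: r => [|i r IH] Pfs.
  under eq_fun do rewrite big_nil.
  by have := P_itv 0 0 0; under eq_fun do rewrite rscaler0.
under eq_fun do rewrite big_cons.
apply: P_add; first by apply: Pfs; rewrite mem_head.
by apply: IH => j jr; apply: Pfs; rewrite inE jr orbT.
Qed.

Lemma L2w_ind_indic_bigcup p q (F : (set R)^nat) : trivIset setT F ->
  (forall k, measurable (F k)) ->
  (forall k h, P (fun t => rscale (\1_(F k `&` `]p, q[) t) h)) ->
  forall h, P (fun t => rscale (\1_((\bigcup_k F k) `&` `]p, q[) t) h).
Proof.
move=> disjF mF PF h; rewrite setI_bigcupl.
have disj : trivIset setT (fun k => F k `&` `]p, q[%classic).
  exact: trivIset_setIr.
apply: (L2w_ind_rscale_dominated (p := p) (q := q) _ _ (sum_indic_cvg disj)).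
- move=> n; apply: measurable_sum => k; apply: measurable_indic.
  exact: measurableI.
- move=> n t; rewrite ger0_norm ?sumr_ge0 //.
  apply: le_trans (sum_indic_le _ disj n t) _.
  by rewrite -setI_bigcupl indicI ler_piMl // indicE lern1 leq_b1.
- move=> n; under eq_fun do rewrite /rscale rmorph_sum scaler_suml.
  by apply: L2w_ind_sum => k _; exact: PF.
Qed.

Lemma L2w_ind_indic p q h A : measurable A ->
  P (fun t => rscale (\1_(A `&` `]p, q[) t) h).
Proof.
have sigmaE : @measurable _ R = <<s @RGenOInfty.G R >>.
  exact: RGenOInfty.measurableE.
move=> mA; rewrite sigmaE in mA; move: A mA h.
apply: (dynkin_induction sigmaE).
- move=> _ _ [x ->] [y ->]; exists (Num.max x y).
  by apply/seteqP; split=> t /=; rewrite !in_itv /= !andbT gt_max => /andP.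
- by move=> h; rewrite setTI.
- move=> _ [x ->] h.
  suff -> : `]x, +oo[%classic `&` `]p, q[ = `]Num.max x p, q[%classic by [].
  apply/seteqP; split=> t /=; rewrite !in_itv /= gt_max andbT.
    by move=> [-> /andP[-> ->]].
  by move=> /andP[/andP[-> ->] ->].
- move=> A mA PA h.
  suff -> : (fun t => rscale (\1_(~` A `&` `]p, q[) t) h) = (fun t =>
      rscale (\1_`]p, q[ t) h + rscale (\1_(A `&` `]p, q[) t) (- h)).
    exact: P_add.
  apply/funext => t; rewrite -rscaleN1 rscaleA -rscaleDl !indicI /=.
  by rewrite indicC [\1_A t]indicE; congr rscale; case: (t \in A) => /=; ring.
- by move=> F mF disjF PF; exact: L2w_ind_indic_bigcup.
Qed.

Lemma L2w_ind_simple s : simple_fun s -> compactly_supported s -> P s.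
Proof.
move=> [fs ms] [M s0]; pose X : seq H := finmap.enum_fset (fset_set (range s)).
pose N := M + 1.
have -> : s = fun t => \sum_(h <- X)
    rscale (\1_((s @^-1` [set h]) `&` `]- N, N[) t) h.
  apply/funext => t.
  have st : s t \in X by rewrite in_fset_set // mem_set //; exists t.
  rewrite (bigD1_seq (s t)) ?finmap.fset_uniq //= big1 => [|h hs]; last first.
    rewrite indicE memNset ?rscale0 // => -[/= sth _].
    by rewrite sth eqxx in hs.
  rewrite addr0 indicE.
  have [tM|/s0 ->] := leP `|t| M; last by rewrite rscaler0.
  rewrite mem_set ?rscale1 //; split => //=; rewrite in_itv /= -ltr_norml.
  by rewrite (le_lt_trans tM) // ltrDl.
by apply: L2w_ind_sum => h _; exact: L2w_ind_indic.
Qed.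

Lemma L2w_ind f : L2w rho f -> P f.
Proof.
move=> lf; have [fs [sfs cfs fsf]] := L2w_simple_approx hH lf.
by apply: P_lim lf fsf => n; exact: L2w_ind_simple.
Qed.

End L2wInduction.

Section Density.
Context (R : realType) (b : bool) (H : lmodType (scal R b)).
Context (ip : H -> H -> scal R b) (hH : is_hilbert ip).
Local Notation hn := (hnorm ip).
Local Notation L2w := (L2w ip).
Local Notation wnorm := (wnorm ip).
Implicit Types (f g : R -> H) (fs us : nat -> R -> H) (phi : R -> R) (h : H).

Lemma hderiv_rscale phi t d h : is_derive t (1 : R) phi d ->
  hderiv ip (fun s => rscale (phi s) h) t (rscale d h).
Proof.
move=> [dphi dE].
have cd : k^-1 * (phi (t + k) - phi t) @[k --> (0 : R)^'] --> d.
  rewrite -dE [X in X @ _ --> _](_ : _ =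
    fun k => k^-1 *: ((phi \o shift t) (k *: (1 : R)) - phi t)) //.
  by apply/funext => k; rewrite /= /GRing.scale /= mulr1 (addrC t).
have quotientE k : (sofR b k)^-1 *: (rscale (phi (t + k)) h - rscale (phi t) h)
    = rscale (k^-1 * (phi (t + k) - phi t)) h.
  by rewrite -rscaleBl -rscaleA [in RHS]/rscale fmorphV.
by rewrite /hderiv; under eq_fun do rewrite quotientE; exact: cvg_rscale.
Qed.

Lemma hderivD f g t u v : hderiv ip f t u -> hderiv ip g t v ->
  hderiv ip (fun s => f s + g s) t (u + v).
Proof.
move=> fu gv; apply: (cvg_dist_le (v := fun k =>
    hn ((sofR b k)^-1 *: (f (t + k) - f t) - u)
    + hn ((sofR b k)^-1 *: (g (t + k) - g t) - v))) => [k|].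
  rewrite subr0 ger0_norm ?hnorm_ge0 //; apply: le_trans (ler_hnormD hH _ _).
  by rewrite addrACA -opprD -scalerDr addrACA -opprD.
by rewrite -[X in _ --> X]addr0; apply: cvgD.
Qed.

Lemma CcD f g : Cc ip f -> Cc ip g -> Cc ip (fun t => f t + g t).
Proof.
move=> [[Df [Df0 dDf]] [M fM]] [[Dg [Dg0 dDg]] [N gN]]; split.
  exists (fun n t => Df n t + Dg n t).
  split=> [|n t]; first by rewrite Df0 Dg0.
  exact: hderivD.
exists (Num.max M N) => t; rewrite gt_max => /andP[/fM -> /gN ->].
by rewrite addr0.
Qed.

Lemma Cc_rscale phi h : smooth phi -> compactly_supported phi ->
  Cc ip (fun t => rscale (phi t) h).
Proof.
move=> [Dv [Dv0 dDv]] [M phi0]; split; last first.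
  by exists M => t /phi0 ->; rewrite rscale0.
exists (fun n t => rscale (Dv n t) h); split => [|n t]; first by rewrite Dv0.
exact: hderiv_rscale.
Qed.

Lemma Cc_Cplus f : Cc ip f -> Cplus ip f.
Proof.
move=> [[Dv [D0 dD]] [M fM]]; exists Dv; split => //.
  exists `|M| => t Mt; apply: fM.
  by have := ler_norm M; have := ler_norm t; lra.
by exists 0%N, M => t /fM; rewrite D0.
Qed.

Definition Cc_approximable rho f : Prop := L2w rho f /\
  forall e : R, 0 < e -> exists u,
    [/\ Cc ip u, L2w rho u & wnorm rho (fun t => f t - u t) < e].

Lemma Cc_approximable_refl rho u : Cc ip u -> L2w rho u ->
  Cc_approximable rho u.
Proof.
move=> cu lu; split=> // e e0; exists u; split=> //.
by under eq_fun do rewrite subrr; rewrite wnorm_cst0.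
Qed.

Lemma Cc_approximableD rho f g : Cc_approximable rho f ->
  Cc_approximable rho g -> Cc_approximable rho (fun t => f t + g t).
Proof.
move=> [lf af] [lg ag]; split=> [|e e0]; first exact: L2wD.
have e2 : 0 < e / 2 by rewrite divr_gt0.
have [u [cu lu fu]] := af _ e2; have [v [cv lv gv]] := ag _ e2.
exists (fun t => u t + v t); split; [exact: CcD|exact: L2wD|].
rewrite (splitr e); apply: le_lt_trans (ltrD fu gv).
under eq_fun do rewrite opprD addrACA.
exact: ler_wnormD (L2wB hH lf lu) (L2wB hH lg lv).
Qed.

Lemma Cc_approximable_lim rho fs f : (forall n, Cc_approximable rho (fs n)) ->
  L2w rho f -> wcvg ip rho fs f -> Cc_approximable rho f.
Proof.
move=> afs lf fsf; split=> // e e0.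
have e2 : 0 < e / 2 by rewrite divr_gt0.
have [n _ /(_ n (leqnn n)) fn] := cvgr_lt _ fsf _ e2.
have [ln /(_ _ e2) [u [cu lu fu]]] := afs n.
exists u; split=> //; rewrite (splitr e).
apply: le_lt_trans (ltrD fn fu); rewrite (wnorm_distrC hH _ (fs n) f).
exact: ler_wnorm_distD.
Qed.

Lemma Cc_approximable_itv rho p q h :
  Cc_approximable rho (fun t => rscale (\1_`]p, q[ t) h).
Proof.
have c0 n : 0 < n.+1%:R^-1 :> R by rewrite invr_gt0.
pose bumps n := bump_fun n.+1%:R^-1 p q.
have cbumps n : continuous (bumps n) by exact: bump_fun_continuous.
have sbumps n : compactly_supported (bumps n).
  exact: bump_fun_compactly_supported.
have l1 := L2w_rscale_indic_itv hH rho p q h.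
have cv : wcvg ip rho (fun n t => rscale (bumps n t) h)
    (fun t => rscale (\1_`]p, q[ t) h).
  apply: (wcvg_rscale_dominated hH _ _ _ _ l1) => [n||n t|t|].
  - exact: continuous_measurable_fun.
  - exact: measurable_indic.
  - exact: bump_fun_le_indic.
  - by rewrite ger0_norm.
  - exact: bump_fun_cvg.
apply: Cc_approximable_lim l1 cv => n; apply: Cc_approximable_refl.
  by apply: Cc_rscale => //; exact: bump_fun_smooth.
exact: L2w_rscale_continuous.
Qed.

Lemma Cc_dense rho f : L2w rho f -> exists us,
  [/\ forall n, Cc ip (us n), forall n, L2w rho (us n) & wcvg ip rho us f].
Proof.
move=> lf; have [_ af] : Cc_approximable rho f.
  apply: (L2w_ind hH (P := Cc_approximable rho)) lf => [p q h|g g'|gs g].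
  - exact: Cc_approximable_itv.
  - exact: Cc_approximableD.
  - exact: Cc_approximable_lim.
have /choice[us hus] n : exists u, [/\ Cc ip u, L2w rho u &
    wnorm rho (fun t => f t - u t) < n.+1%:R^-1].
  by apply: af; rewrite invr_gt0.
exists us; split=> [n|n|]; [by case: (hus n)|by case: (hus n)|].
apply: (cvg_dist_le (v := fun n => n.+1%:R^-1)) => [n|].
  rewrite subr0 ger0_norm ?wnorm_ge0 // wnorm_distrC //.
  by case: (hus n) => _ _ /ltW.
exact: cvg_harmonic.
Qed.

End Density.

Section LipschitzExtension.
Context (R : realType) (b : bool) (H : lmodType (scal R b)).
Context (ip : H -> H -> scal R b) (hH : is_hilbert ip).
Local Notation L2w := (L2w ip).
Local Notation wnorm := (wnorm ip).
Local Notation wip := (wip ip).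
Implicit Types (f g u w x y : R -> H) (rho sigma M C : R).
Implicit Types (F : (R -> H) -> (R -> H) -> scal R b) (Fr : (R -> H) -> R -> H).

Lemma wnorm_le_dual rho sigma f M : L2w rho f -> 0 <= M ->
  (forall psi, Cc ip psi -> L2w sigma psi ->
     wip rho sigma f psi <= M * wnorm sigma psi) ->
  wnorm rho f <= M.
Proof.
move=> lf M0 bound; have ldual := L2w_reweight hH sigma lf.
have [us [cus lus cv]] := Cc_dense hH ldual.
have : wip rho sigma f (reweight rho sigma f)
    <= M * wnorm sigma (reweight rho sigma f).
  apply: ler_cvg_to (wcvg_wip hH lf lus ldual cv)
    (cvgMl_tmp (a := M) (wcvg_wnorm hH lus ldual cv)) _.
  by apply: nearW => n; exact: bound (cus n) (lus n).
rewrite wip_reweightr // wnorm_reweight // -wnorm_sqr // expr2.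
have := wnorm_ge0 ip rho f; rewrite le_eqVlt => /predU1P[<- //|fpos].
by rewrite ler_pM2r.
Qed.

Lemma sre_pairing rho f g : sre (pairing ip f g) = wip rho (- rho) f g.
Proof.
transitivity (\int[@lebesgue_measure R]_t rip ip (f t) (g t)).
  exact: sre_kint.
by apply: eq_Rintegral => t _; rewrite weightNr mulr1.
Qed.

Definition dual_lipschitz rho C F : Prop := forall u w psi,
  Cc ip u -> Cc ip w -> Cplus ip psi ->
  kabs (F u psi - F w psi)
    <= C * wnorm (- rho) psi * wnorm rho (fun t => u t - w t).

Definition wlipschitz rho C Fr : Prop := forall x y, L2w rho x -> L2w rho y ->
  wnorm rho (fun t => Fr x t - Fr y t) <= C * wnorm rho (fun t => x t - y t).

Lemma cont_ext_wcvg rho F Fr (xs : nat -> R -> H) x : cont_ext ip rho F Fr ->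
    (forall n, L2w rho (xs n)) -> L2w rho x -> wcvg ip rho xs x ->
  wcvg ip rho (fun n => Fr (xs n)) (Fr x).
Proof.
move=> [_ Frc _] lxs lx cv; apply/cvgrPdist_lt => e e0.
have [d d0 Frd] := Frc _ lx _ e0.
apply: filterS (cvgr_lt _ cv _ d0) => n.
by rewrite sub0r normrN ger0_norm ?wnorm_ge0 //; exact: Frd.
Qed.

Lemma cont_ext_lipschitz_Cc rho C F Fr : 0 <= C -> cont_ext ip rho F Fr ->
  dual_lipschitz rho C F ->
  forall u w, Cc ip u -> L2w rho u -> Cc ip w -> L2w rho w ->
    wnorm rho (fun t => Fr u t - Fr w t) <= C * wnorm rho (fun t => u t - w t).
Proof.
move=> C0 [FrL _ FrF] lip u w cu lu cw lw.
have [lFu lFw] := (FrL _ lu, FrL _ lw).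
apply: (@wnorm_le_dual _ (- rho)) => [||psi cpsi lpsi].
- exact: L2wB.
- by rewrite mulr_ge0 ?wnorm_ge0.
have Ppsi := Cc_Cplus cpsi.
have -> : wip rho (- rho) (fun t => Fr u t - Fr w t) psi =
    sre (F u psi - F w psi).
  by rewrite raddfB /= !FrF // !(sre_pairing rho) wipBl.
by rewrite mulrAC; apply: le_trans (ler_sre_kabs _) (lip _ _ _ cu cw Ppsi).
Qed.

Lemma cont_ext_wlipschitz rho C F Fr : 0 <= C -> cont_ext ip rho F Fr ->
  dual_lipschitz rho C F -> wlipschitz rho C Fr.
Proof.
move=> C0 extF lip x y lx ly; have [FrL _ _] := extF.
have [xs [cxs lxs xsx]] := Cc_dense hH lx.
have [ys [cys lys ysy]] := Cc_dense hH ly.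
have lFxs n : L2w rho (Fr (xs n)) by exact: FrL.
have lFys n : L2w rho (Fr (ys n)) by exact: FrL.
have Fxs := cont_ext_wcvg extF lxs lx xsx.
have Fys := cont_ext_wcvg extF lys ly ysy.
have cvl := wcvg_wnorm hH (fun n => L2wB hH (lFxs n) (lFys n))
  (L2wB hH (FrL _ lx) (FrL _ ly))
  (wcvgB hH lFxs lFys (FrL _ lx) (FrL _ ly) Fxs Fys).
have cvr := wcvg_wnorm hH (fun n => L2wB hH (lxs n) (lys n)) (L2wB hH lx ly)
  (wcvgB hH lxs lys lx ly xsx ysy).
apply: ler_cvg_to cvl (cvgMl_tmp (a := C) cvr) _; apply: nearW => n.
exact: (cont_ext_lipschitz_Cc C0 extF lip).
Qed.

Lemma wlipschitz_dist_le rho C D Fr Gr u w :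
    {homo Fr : x / L2w rho x} -> {homo Gr : x / L2w rho x} ->
    wlipschitz rho C Fr -> wlipschitz rho D Gr -> L2w rho u -> L2w rho w ->
  2 * wnorm rho (fun t => Fr u t - Gr w t) <=
  (C + D) * wnorm rho (fun t => u t - w t)
  + (wnorm rho (fun t => Fr u t - Gr u t)
     + wnorm rho (fun t => Fr w t - Gr w t)).
Proof.
move=> FrL GrL lipF lipG lu lw.
have := ler_wnorm_distD hH (FrL _ lu) (FrL _ lw) (GrL _ lw).
have := ler_wnorm_distD hH (FrL _ lu) (GrL _ lu) (GrL _ lw).
have := lipF _ _ lu lw; have := lipG _ _ lu lw.
by do 6!move: (wnorm rho _) => ?; lra.
Qed.

End LipschitzExtension.

Section WeakDerivative.
Context (R : realType) (b : bool) (H : lmodType (scal R b)).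
Context (ip : H -> H -> scal R b) (hH : is_hilbert ip).
Local Notation mu := (@lebesgue_measure R).
Local Notation L2w := (L2w ip).
Local Notation wnorm := (wnorm ip).
Local Notation wip := (wip ip).
Implicit Types (f g v psi : R -> H) (rho sigma : R) (phi chi : R -> R) (h : H).

Lemma weak_deriv_rip psi g :
  (forall h phi, test_fun phi ->
    \int[mu]_t (rip ip (psi t) h * derive1 phi t) =
    - \int[mu]_t (rip ip (g t) h * phi t)) -> weak_deriv ip psi g.
Proof.
move=> hyp h phi tphi; have [c simE] := @sim_as_sre R b.
apply: scal_ext; rewrite raddfN /= !(sre_kint, sim_kint).
  have := hyp h phi tphi; congr (_ = - _); apply: eq_Rintegral => t _;
    by rewrite [in RHS]mulrC sre_sofRM mulrC.
have := hyp (c *: h) phi tphi; congr (_ = - _); apply: eq_Rintegral => t _;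
  by rewrite /rip ipZr // -simE [in RHS]mulrC sim_sofRM mulrC.
Qed.

Lemma weak_deriv_rscale_C1 chi h : C1_fun chi ->
  weak_deriv ip (fun t => rscale (chi t) h) (fun t => rscale (derive1 chi t) h).
Proof.
move=> C1chi; apply: weak_deriv_rip => h' phi /test_fun_C1c C1cphi.
have [C1phi sphi] := C1cphi.
under eq_Rintegral do rewrite ripZl // mulrAC mulrC.
under [in RHS]eq_Rintegral do rewrite ripZl // mulrAC mulrC.
rewrite !RintegralZl //; first by rewrite Rintegration_by_parts_C1c // mulrN.
  apply: continuous_compactly_supported_integrable.
    by move=> t; apply: cvgM; [exact: C1chi.2|exact: C1_continuous].
  exact: compactly_supportedMr.
apply: continuous_compactly_supported_integrable.
  by move=> t; apply: cvgM; [exact: C1_continuous|exact: C1phi.2].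
by apply: compactly_supportedMr; exact: compactly_supported_derive1.
Qed.

(* The real part of [v' = f] in [H_{rho,-1}]; [g] is the derivative of [psi]. *)
Definition weak_solution rho v f : Prop := forall psi g,
  L2w (- rho) psi -> L2w (- rho) g -> weak_deriv ip psi g ->
  wip rho (- rho) v g = - wip rho (- rho) f psi.

Lemma weak_deriv_reweight rho sigma v f : L2w rho v -> L2w rho f ->
  weak_solution rho v f ->
  weak_deriv ip (reweight rho sigma v)
    (reweight rho sigma (fun t => f t - rscale (rho - sigma) (v t))).
Proof.
move=> lv lf sol; apply: weak_deriv_rip => h phi /test_fun_C1c[C1phi sphi].
set a := rho - sigma; pose chi t := weight a t * phi t.
have C1chi : C1_fun chi by apply: C1M => //; exact: C1_weight.
have schi : compactly_supported chi by exact: compactly_supportedMr.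
have chi'E t : derive1 chi t = weight a t * derive1 phi t - a * chi t.
  rewrite derive1E; have [_ ->] := is_derive1M
    ((C1_weight a).1 t) (C1phi.1 t).
  by rewrite derive1_weight /chi; ring.
have lchi : L2w (- rho) (fun t => rscale (chi t) h).
  by apply: L2w_rscale_continuous => //; exact: C1_continuous.
have lchi' : L2w (- rho) (fun t => rscale (derive1 chi t) h).
  apply: L2w_rscale_continuous => //; first exact: C1chi.2.
  exact: compactly_supported_derive1.
have testE g (eta : R -> R) :
    \int[mu]_t (rip ip (reweight rho sigma g t) h * eta t) =
    wip rho (- rho) g (fun t => rscale (weight a t * eta t) h).
  apply: eq_Rintegral => t _.
  by rewrite ripZl // ripZr // weightNr /a; ring.
have productE : (fun t => rscale (weight a t * derive1 phi t) h) =
    fun t => rscale (derive1 chi t) h + rscale a (rscale (chi t) h).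
  by apply/funext => t; rewrite rscaleA -rscaleDl chi'E subrK.
rewrite !testE productE.
have lav := L2wZ hH a lv; have lachi := L2wZ hH a lchi.
rewrite (wipDr hH lv lchi' lachi) (wipZr hH a lv lchi).
rewrite (wipBl hH lf lav lchi) (wipZl hH a lv lchi).
by rewrite (sol _ _ lchi lchi') ?opprB 1?addrC //; exact: weak_deriv_rscale_C1.
Qed.

(* The equation [v' = f] may be tested with [exp (- 2 rho t) v], whose weak
   derivative is [exp (- 2 rho t) (f - 2 rho v)]. *)
Lemma energy_identity rho v f : L2w rho v -> L2w rho f ->
  weak_solution rho v f -> rho * wnorm rho v ^+ 2 = wip rho rho v f.
Proof.
move=> lv lf sol; have lcv := L2wZ hH (rho - - rho) lv.
have := sol _ _ (L2w_reweight hH (- rho) lv)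
  (L2w_reweight hH (- rho) (L2wB hH lf lcv)) (weak_deriv_reweight _ lv lf sol).
rewrite !wip_reweightr // wipBr // wipZr // (wipC hH _ _ f v) wnorm_sqr //.
by lra.
Qed.

Lemma energy_estimate rho v f : L2w rho v -> L2w rho f ->
  weak_solution rho v f -> rho * wnorm rho v <= wnorm rho f.
Proof.
move=> lv lf sol; have := le_trans (ler_norm _) (CauchySchwarz_wip hH lv lf).
rewrite -(energy_identity lv lf sol) expr2 mulrCA.
have := wnorm_ge0 ip rho v; rewrite le_eqVlt => /predU1P[<- _|vpos].
  by rewrite mulr0 wnorm_ge0.
by rewrite ler_pM2l.
Qed.

Lemma weak_solutionB rho v v' f f' : L2w rho v -> L2w rho v' -> L2w rho f ->
    L2w rho f' -> weak_solution rho v f -> weak_solution rho v' f' ->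
  weak_solution rho (fun t => v t - v' t) (fun t => f t - f' t).
Proof.
move=> lv lv' lf lf' sol sol' psi g lpsi lg wd.
by rewrite !wipBl // (sol psi) // (sol' psi) // opprB opprK addrC.
Qed.

End WeakDerivative.

Section Stability.
Context (R : realType) (b : bool) (H : lmodType (scal R b)).
Context (ip : H -> H -> scal R b) (hH : is_hilbert ip).
Local Notation hn := (hnorm ip).
Local Notation mu := (@lebesgue_measure R).
Local Notation L2w := (L2w ip).
Local Notation wnorm := (wnorm ip).
Implicit Types (u w : R -> H) (rho : R) (h : H) (Fr Gr : (R -> H) -> R -> H).

Lemma chi_posE h : chi_pos h = fun t => rscale (\1_`]0, +oo[ t) h.
Proof.
apply/funext => t; rewrite /chi_pos indicE mem_setE in_itv /= andbT.
by case: ifP => _; rewrite ?rscale1 ?rscale0.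
Qed.

Lemma smeas_chi_pos h : smeas ip (chi_pos h).
Proof.
by rewrite chi_posE; apply: smeas_rscale_cst => //; exact: measurable_indic.
Qed.

(* Almost everywhere, the weighted square of the jump is a multiple of the
   density of an exponential law. *)
Lemma wnorm2_chi_pos rho h : 0 < rho ->
  wnorm2 ip rho (chi_pos h) = (hn h ^+ 2 / (2 * rho))%:E.
Proof.
move=> rho0; have r2 : 0 < 2 * rho by rewrite mulr_gt0.
have r0 : 0 <= hn h ^+ 2 / (2 * rho) by rewrite divr_ge0 ?sqr_ge0 // ltW.
transitivity (\int[mu]_t ((hn h ^+ 2 / (2 * rho))%:E *
    (exponential_pdf (2 * rho) t)%:E))%E; last first.
  rewrite ge0_integralZl_EFin //.
  - by rewrite integral_exponential_pdf // mule1.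
  - by move=> t _; rewrite lee_fin exponential_pdf_ge0 // ltW.
  - by apply/measurable_EFinP; exact: measurable_exponential_pdf.
apply: ae_eq_integral => //.
- apply/measurable_EFinP; apply: measurable_funM.
    apply: measurable_funX; apply: (measurable_hnorm hH).
    exact: smeas_chi_pos.
  exact: (measurable_weight (2 * rho)).
- apply/measurable_EFinP; apply: measurable_funM; first exact: measurable_cst.
  exact: measurable_exponential_pdf.
- exists [set 0]; split; first exact: measurable_set1.
    exact: lebesgue_measure_set1.
  move=> t /= nt; apply: contrapT => /eqP t0; apply: nt => _.
  rewrite /chi_pos -EFinM; congr EFin.
  case: ltgtP t0 => // [t0|t0] _.
    rewrite exponential_pdfE; last exact: ltW.
    by rewrite mulrA divfK ?gt_eqF //; congr (_ * expR _); ring.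
  by rewrite lt0_exponential_pdf // hnorm0 // expr0n mul0r mulr0.
Qed.

Lemma L2w_chi_pos rho h : 0 < rho -> L2w rho (chi_pos h).
Proof.
move=> rho0; split; first exact: smeas_chi_pos.
by rewrite wnorm2_chi_pos // ltry.
Qed.

Lemma wnorm_chi_pos rho h : 0 < rho ->
  wnorm rho (chi_pos h) = hn h / Num.sqrt (2 * rho).
Proof.
move=> rho0; rewrite /wnorm wnorm2_chi_pos //= sqrtrM ?sqr_ge0 //.
by rewrite sqrtrV ?mulr_ge0 ?ltW // sqrtr_sqr ger0_norm ?hnorm_ge0.
Qed.

Lemma chi_posB h h' t : chi_pos (h - h') t = chi_pos h t - chi_pos h' t.
Proof. by rewrite /chi_pos; case: ifP; rewrite ?subrr. Qed.

Lemma solves_weak_solution rho Fr (u0 : H) u : 0 < rho ->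
  L2w rho (Fr u) -> solves ip rho Fr u0 u ->
  weak_solution ip rho (fun t => u t - chi_pos u0 t) (Fr u).
Proof.
move=> rho0 lFu [lu sol] psi g lpsi lg wd; have lchi := L2w_chi_pos u0 rho0.
have /(congr1 (@sre R b)) := sol psi g lpsi lg wd.
by rewrite raddfD /= !(sre_pairing ip rho) !wipNr // wipBl //; lra.
Qed.

Lemma solves_dist_le rho Fr Gr (u0 w0 : H) u w : 0 < rho ->
  L2w rho (Fr u) -> L2w rho (Gr w) ->
  solves ip rho Fr u0 u -> solves ip rho Gr w0 w ->
  2 * rho * wnorm rho (fun t => u t - w t) <=
  Num.sqrt (2 * rho) * hn (u0 - w0) + 2 * wnorm rho (fun t => Fr u t - Gr w t).
Proof.
move=> rho0 lFu lGw solu solw; have [[lu _] [lw _]] := (solu, solw).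
have lu' := L2wB hH lu (L2w_chi_pos u0 rho0).
have lw' := L2wB hH lw (L2w_chi_pos w0 rho0).
have energy := energy_estimate hH (L2wB hH lu' lw') (L2wB hH lFu lGw)
  (weak_solutionB hH lu' lw' lFu lGw (solves_weak_solution rho0 lFu solu)
    (solves_weak_solution rho0 lGw solw)).
have splitE : (fun t => u t - w t) = (fun t =>
    (u t - chi_pos u0 t - (w t - chi_pos w0 t)) + chi_pos (u0 - w0) t).
  apply/funext => t; rewrite chi_posB.
  rewrite -[LHS](subrK (chi_pos u0 t - chi_pos w0 t)); congr (_ + _).
  by rewrite !opprD addrACA.
have := ler_wnormD hH (L2wB hH lu' lw') (L2w_chi_pos (u0 - w0) rho0).
rewrite -splitE wnorm_chi_pos // => dist_le.
have r0 : 0 < 2 * rho by rewrite mulr_gt0.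
have sqrtE : 2 * rho * (hn (u0 - w0) / Num.sqrt (2 * rho)) =
    Num.sqrt (2 * rho) * hn (u0 - w0).
  have := sqr_sqrtr (ltW r0).
  have q0 : 0 < Num.sqrt (2 * rho) by rewrite sqrtr_gt0.
  by move: (Num.sqrt _) q0 => q q0 <-; field; rewrite gt_eqF.
have := ler_wpM2l (ltW r0) dist_le; rewrite -sqrtE mulrDr; move: energy.
by do 3!move: (wnorm rho _) => ?; lra.
Qed.

Lemma solves_stability rho C D Fr Gr (u0 w0 : H) u w : 0 < rho ->
    {homo Fr : x / L2w rho x} -> {homo Gr : x / L2w rho x} ->
    wlipschitz ip rho C Fr -> wlipschitz ip rho D Gr ->
    solves ip rho Fr u0 u -> solves ip rho Gr w0 w ->
  (2 * rho - (C + D)) * wnorm rho (fun t => u t - w t) <=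
  Num.sqrt (2 * rho) * hn (u0 - w0)
  + (wnorm rho (fun t => Fr u t - Gr u t)
     + wnorm rho (fun t => Fr w t - Gr w t)).
Proof.
move=> rho0 FrL GrL lipF lipG solu solw; have [[lu _] [lw _]] := (solu, solw).
have := wlipschitz_dist_le hH FrL GrL lipF lipG lu lw.
have := solves_dist_le rho0 (FrL _ lu) (GrL _ lw) solu solw.
by rewrite mulrBl; do 4!move: (wnorm rho _) => ?; lra.
Qed.

End Stability.

Theorem theorem5p5 (R : realType) (b : bool)
  (H : lmodType (scal R b)) (ip : H -> H -> scal R b)
  (hH : is_hilbert ip)
  (C D : R) (hC : 0 < C) (hD : 0 < D)
  (F G : (R -> H) -> (R -> H) -> scal R b)
  (linF : lin_functional_map ip F) (linG : lin_functional_map ip G)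
  (hFG : forall rho : R, Num.max C D < rho -> exists2 Kc : R, 0 < Kc &
     forall u w psi : R -> H, Cc ip u -> Cc ip w -> Cplus ip psi ->
     [/\ kabs (F u psi - F w psi)
           <= C * wnorm ip (- rho) psi * wnorm ip rho (fun t => u t - w t),
         kabs (G u psi - G w psi)
           <= D * wnorm ip (- rho) psi * wnorm ip rho (fun t => u t - w t),
         kabs (F (fun _ => 0) psi) <= Kc * wnorm ip (- rho) psi &
         kabs (G (fun _ => 0) psi) <= Kc * wnorm ip (- rho) psi])
  (rho : R) (hrho : Num.max C D < rho) (u0 w0 : H)
  (Fr Gr : (R -> H) -> R -> H)
  (hFr : cont_ext ip rho F Fr) (hGr : cont_ext ip rho G Gr)
  (u w : R -> H)
  (hu : solves ip rho Fr u0 u) (hw : solves ip rho Gr w0 w) :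
  ((wnorm ip rho (fun t => u t - w t))%:E
   <= ((2 * rho - (C + D))^-1)%:E *
      ((Num.sqrt (2 * rho) * hnorm ip (u0 - w0))%:E
       + 2%:E * ereal_sup [set (wnorm ip rho (fun t => Fr x t - Gr x t))%:E
                          | x in L2w ip rho]))%E.
Proof.
have [lC lD] : C < rho /\ D < rho by move: hrho; rewrite gt_max => /andP.
have gap : 0 < 2 * rho - (C + D) by lra.
have [Kc _ bounds] := hFG rho hrho.
have lipF : wlipschitz ip rho C Fr.
  apply: (cont_ext_wlipschitz hH (ltW hC) hFr) => x y psi cx cy cpsi.
  by case: (bounds _ _ _ cx cy cpsi).
have lipG : wlipschitz ip rho D Gr.
  apply: (cont_ext_wlipschitz hH (ltW hD) hGr) => x y psi cx cy cpsi.
  by case: (bounds _ _ _ cx cy cpsi).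
have [[[FrL _ _] [GrL _ _]] [[lu _] [lw _]]] := ((hFr, hGr), (hu, hw)).
have dist :=
  solves_stability hH (lt_trans hC lC) FrL GrL lipF lipG hu hw.
apply: (lee_pdivl_addM2 gap dist); apply: ereal_sup_ubound.
  by exists u.
by exists w.
Qed.
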